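(* Let $F_1$ and $F_2$ be free groups of finite ranks $n$ and $m$ respectively, let $t_1\in F_1$ and $t_2\in F_2$ be nontrivial elements, and let $G=F_1*_{\langle t\rangle}F_2$ be the amalgamated free product identifying $t_1$ with $t_2$ (denoted $t$). If $t$ is indivisible in at least one of $F_1,F_2$ and $G$ has corank $n+m-1$, then $G$ is free.
   Context: An element $g$ of a group is indivisible if $h^k=g$ implies $k=\pm1$. The corank of a finitely generated group is the maximal rank of a free group onto which it surjects. *)

(* Defs.v *)
From Stdlib Require Import ZArith Arith.

Record group := Group {
  carrier :> Type;
  gmul : carrier -> carrier -> carrier;
  gone : carrier;
  ginv : carrier -> carrier;
  gmulA : forall x y z, gmul x (gmul y z) = gmul (gmul x y) z;
  gmul1g : forall x, gmul gone x = x;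
  gmulg1 : forall x, gmul x gone = x;
  gmulVg : forall x, gmul (ginv x) x = gone;
  gmulgV : forall x, gmul x (ginv x) = gone
}.
Arguments gmul {g}.
Arguments gone {g}.
Arguments ginv {g}.

Fixpoint gpow_nat {G : group} (x : G) (k : nat) : G :=
  match k with O => gone | S k' => gmul x (gpow_nat x k') end.

Definition gpow {G : group} (x : G) (k : Z) : G :=
  match k with
  | Z0 => gone
  | Zpos p => gpow_nat x (Pos.to_nat p)
  | Zneg p => ginv (gpow_nat x (Pos.to_nat p))
  end.

Definition indivisible {G : group} (g : G) : Prop :=
  forall (h : G) (k : Z), gpow h k = g -> k = 1%Z \/ k = (-1)%Z.

Definition is_hom {G H : group} (f : G -> H) : Prop :=
  forall x y, f (gmul x y) = gmul (f x) (f y).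

Definition surjective {A B : Type} (f : A -> B) : Prop := forall y, exists x, f x = y.

Definition free_basis {G : group} {I : Type} (b : I -> G) : Prop :=
  forall (H : group) (f : I -> H),
    exists phi : G -> H, is_hom phi /\ (forall i, phi (b i) = f i) /\
      (forall psi : G -> H, is_hom psi -> (forall i, psi (b i) = f i) ->
         forall x, psi x = phi x).

Definition fin (n : nat) : Type := {i : nat | i < n}.

Definition free_of_rank (G : group) (n : nat) : Prop :=
  exists b : fin n -> G, free_basis b.

Definition is_free (G : group) : Prop :=
  exists (I : Type) (b : I -> G), free_basis b.

Definition surjects_onto_free (G : group) (r : nat) : Prop :=
  exists (Fr : group) (f : G -> Fr), free_of_rank Fr r /\ is_hom f /\ surjective f.

Definition corank_is (G : group) (r : nat) : Prop :=
  surjects_onto_free G r /\ (forall r', surjects_onto_free G r' -> r' <= r).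

(* (G, j1, j2) is the amalgamated free product F1 *_{t1 = t2} F2, i.e. the pushout
   of F1 <- <t> -> F2 (t |-> t1, t |-> t2) in the category of groups. *)
Definition amalgam {F1 F2 G : group} (t1 : F1) (t2 : F2) (j1 : F1 -> G) (j2 : F2 -> G) : Prop :=
  is_hom j1 /\ is_hom j2 /\ j1 t1 = j2 t2 /\
  forall (H : group) (f1 : F1 -> H) (f2 : F2 -> H),
    is_hom f1 -> is_hom f2 -> f1 t1 = f2 t2 ->
    exists phi : G -> H, is_hom phi /\ (forall x, phi (j1 x) = f1 x) /\
      (forall y, phi (j2 y) = f2 y) /\
      (forall psi : G -> H, is_hom psi -> (forall x, psi (j1 x) = f1 x) ->
         (forall y, psi (j2 y) = f2 y) -> forall z, psi z = phi z).

(* Main.v *)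
(* Let f : G -> F be onto a free group of rank r = n + m - 1, let c be the
   image of t, and let R = k[F] with k a field.  By Nielsen reduction of the
   images of the n + m basis elements x_i, the left R-module of relations
   sum y_i (f(x_i) - 1) = 0 is generated by one of them, p.  As R has no zero
   divisors, this forces f to be injective on F1 and on F2.
   The Fox derivatives of t1 and t2 form a relation, say a p, and a divides
   c - 1 on the left.  Conjugation turns a bi-invariant order of F into an order
   of the right cosets of the centralizer C of c; leading terms then show that
   a is supported on a single coset of C.  If t1 is indivisible, C meets
   f(F1) in <c>, and since the Fox derivatives of t1 are not all divisible by
   c - 1, a is a unit.  Hence the Fox derivatives of t1 and t2 generate all
   relations: this says that the graph with vertices F/f(F1), F/f(F2) and edges
   F/<c> has no cycle, so that F is the amalgam and f is an isomorphism. *)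

Require Import Defs.
From Stdlib Require Import ZArith Arith.
From HB Require Import structures.
From mathcomp Require Import all_boot all_order all_algebra finmap.
From mathcomp.multinomials Require Import monalg.
From mathcomp.classical Require boolp.
From mathcomp Require Import zify.
Set Implicit Arguments.
Unset Strict Implicit.
Unset Printing Implicit Defensive.

(** * Words and their numeral weight *)

(** The rank n + m - 1 enters through Nielsen reduction: the images of the n + m basis elements
    reduce to the r basis letters, up to inversion, and one trivial entry; the unit vector at that
    entry, carried back through the moves, is p. Length alone does not drive the reduction, since an
    entry may lose exactly half of itself on either side; a numeral weight breaks these ties. The
    obstacle is that R is noncommutative and a divides c - 1 on one side only, so unique
    factorization is not at hand. The bi-order, taken from the Magnus expansion, replaces it by
    control of supports. The augmentation then shows that a is a unit, because modulo the right
    ideal (c - 1) R a coset <c> x collapses to one element. For the last step no tree is built. A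
    word in the two factors is a path in the graph, and the sum of the coefficients over <c> is a
    functional that vanishes on R (c - 1). On the F1 part of the telescoping sum of a path that
    leaves the edge <c> on one side and first returns to it from the other, this functional would be
    1 or -1. *)

Section Numeral.
Variable X : finType.
Implicit Types u v w : seq X.

(* Digits are positive, so that longer words have larger values. *)
Definition digit (x : X) : nat := (enum_rank x).+1.
(** An injective numbering that refines length. It serves twice: on signed letters it breaks ties in
    Nielsen reduction, and on generators it well-orders the monomials of the Magnus expansion. *)
Definition nu w : nat := foldl (fun acc x => acc * #|X|.+1 + digit x) 0 w.

Lemma nu_foldl a w :
  foldl (fun acc x => acc * #|X|.+1 + digit x) a w = a * #|X|.+1 ^ size w + nu w.
Proof.
rewrite /nu; elim: w a => [|x w IH] a /=; first by rewrite expn0 muln1 addn0.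
by rewrite IH [in RHS]IH mul0n add0n mulnDl expnS mulnA addnA.
Qed.

Lemma nu_cat u v : nu (u ++ v) = nu u * #|X|.+1 ^ size v + nu v.
Proof. by rewrite {1}/nu foldl_cat nu_foldl. Qed.

Lemma digit_lt x : digit x < #|X|.+1.
Proof. by rewrite /digit ltnS ltn_ord. Qed.

Lemma nu_cons x w : nu (x :: w) = digit x * #|X|.+1 ^ size w + nu w.
Proof. by rewrite -cat1s nu_cat /nu /= mul0n add0n. Qed.

Lemma nu_lt w : nu w < #|X|.+1 ^ size w.
Proof.
elim: w => [|x w IH] //; rewrite nu_cons /= expnS.
apply: (@leq_trans ((digit x).+1 * #|X|.+1 ^ size w)).
  by rewrite mulSn addnC ltn_add2r.
by rewrite leq_mul2r digit_lt orbT.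
Qed.

Lemma nu_size u v : size u < size v -> nu u < nu v.
Proof.
case: v => [|x v] // /[!ltnS] le_uv.
apply: leq_trans (nu_lt u) _; rewrite nu_cons.
apply: leq_trans (leq_addr _ _); rewrite /digit mulSn.
by apply: leq_trans (leq_addr _ _); rewrite leq_pexp2l.
Qed.

Lemma nu_inj : injective nu.
Proof.
move=> u v; elim: u v => [|x u IH] [|y v] // E.
- by have := @nu_size [::] (y :: v) isT; rewrite E ltnn.
- by have := @nu_size [::] (x :: u) isT; rewrite E ltnn.
have Es : size u = size v.
  have [||//] := ltngtP (size u) (size v) => Hs.
    by have := @nu_size (x :: u) (y :: v) Hs; rewrite E ltnn.
  by have := @nu_size (y :: v) (x :: u) Hs; rewrite E ltnn.
move: E; rewrite !nu_cons Es => E.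
have Hu := nu_lt u; have Hv := nu_lt v; rewrite Es in Hu.
have Ed : digit x = digit y.
  have := congr1 (fun n => n %/ #|X|.+1 ^ size v) E.
  by rewrite !divnMDl ?expn_gt0 // !divn_small // !addn0.
have -> : x = y by apply: enum_rank_inj; apply: val_inj; case: Ed.
by congr cons; apply: IH; move: E; rewrite Ed; lia.
Qed.
End Numeral.

(** * Reduced words, their product and their common prefixes *)

Section Words.
Variable T : finType.
Implicit Types (l : T * bool) (u v w : seq (T * bool)).

Definition linv l : T * bool := (l.1, ~~ l.2).
Definition noncancel l l' := l' != linv l.
Definition reduced w := sorted noncancel w.
(** Van der Waerden's device: letters act on reduced words by bijections. With the product defined
    by this action, associativity needs no analysis of how far cancellation reaches. *)
Definition lact l w :=
  if w is l' :: w' then if l' == linv l then w' else l :: w else [:: l].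
Definition mulw u v := foldr lact v u.
Definition invw u := rev (map linv u).

Lemma linvK : involutive linv.
Proof. by case=> t b; rewrite /linv /= negbK. Qed.

Lemma linv_neq l : (l == linv l) = false.
Proof. by case: l => t []; apply/negP => /eqP []. Qed.

Lemma eq_linv l l' : l.1 = l'.1 -> l != l' -> l = linv l'.
Proof.
case: l l' => [t b] [t' b'] /= ->; rewrite xpair_eqE eqxx /linv => ne.
by congr pair; case: b b' ne => [] [].
Qed.

Lemma noncancel_linv l l' : noncancel (linv l') (linv l) = noncancel l l'.
Proof. by rewrite /noncancel linvK eq_sym. Qed.

Lemma lact_reduced l w : reduced w -> reduced (lact l w).
Proof.
case: w => [|l' w] //= H; case: eqP => [_|/eqP ne]; first exact: path_sorted H.
by rewrite /= H /noncancel ne.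
Qed.

Lemma mulw_reduced u v : reduced v -> reduced (mulw u v).
Proof. by move=> Hv; elim: u => //= l u; apply: lact_reduced. Qed.

Lemma lactK l w : reduced w -> lact (linv l) (lact l w) = w.
Proof.
case: w => [|l' w] /=; first by rewrite linvK eqxx.
case: eqP => [-> | ne] /=; last by rewrite linvK eqxx.
by case: w => [|l2 w] //= /andP[] /negbTE ->.
Qed.

Lemma mulw_lact l u v : reduced u -> reduced v ->
  mulw (lact l u) v = lact l (mulw u v).
Proof.
case: u => [|l' u] //= Hu Hv; case: eqP => [->|] //=.
by rewrite -{1}[l](linvK l) lactK // mulw_reduced.
Qed.

Lemma mulwA u v w : reduced v -> reduced w ->
  mulw u (mulw v w) = mulw (mulw u v) w.
Proof.
move=> Hv Hw; elim: u => [|l u IH] //=.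
by rewrite mulw_lact ?mulw_reduced // -IH.
Qed.

Lemma mulw_cat u v : reduced (u ++ v) -> mulw u v = u ++ v.
Proof.
elim: u => [|l u IH] //= H; rewrite IH; last exact: path_sorted H.
by case: (u ++ v) H => [|l' s] //= /andP[] /negbTE ->.
Qed.

Lemma mulw0 u : reduced u -> mulw u [::] = u.
Proof. by move=> H; rewrite mulw_cat cats0. Qed.

Lemma invw_cons l u : invw (l :: u) = rcons (invw u) (linv l).
Proof. by rewrite /invw /= rev_cons. Qed.

Lemma invwK : involutive invw.
Proof. by move=> u; rewrite /invw map_rev revK mapK //; apply: linvK. Qed.

Lemma size_invw u : size (invw u) = size u.
Proof. by rewrite size_rev size_map. Qed.

Lemma invw_reduced u : reduced (invw u) = reduced u.
Proof.
rewrite /reduced /invw rev_sorted sorted_map.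
by apply: eq_sorted => l l'; rewrite /= noncancel_linv.
Qed.

Lemma mulVKw u v : reduced v -> mulw (invw u) (mulw u v) = v.
Proof.
move=> Hv; elim: u => //= l u IH.
by rewrite invw_cons /mulw foldr_rcons -/(mulw u v) lactK ?mulw_reduced.
Qed.

Lemma mulVw u : reduced u -> mulw (invw u) u = [::].
Proof. by move=> H; rewrite -{2}(mulw0 H) mulVKw. Qed.

Fixpoint lcp u v :=
  match u, v with
  | l :: u', l' :: v' => if l == l' then (lcp u' v').+1 else 0
  | _, _ => 0
  end.

Lemma lcpC u v : lcp u v = lcp v u.
Proof. by elim: u v => [|l u IH] [|l' v] //=; rewrite eq_sym IH. Qed.

Lemma lcp_sizel u v : lcp u v <= size u.
Proof. by elim: u v => [|l u IH] [|l' v] //=; case: eqP => // _; apply: IH. Qed.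

Lemma lcp_sizer u v : lcp u v <= size v.
Proof. by rewrite lcpC lcp_sizel. Qed.

Lemma take_lcp n u v : n <= lcp u v -> take n u = take n v.
Proof.
elim: u v n => [|l u IH] [|l' v] [|n] //=; case: eqP => // -> Hn.
by rewrite (IH v).
Qed.

Lemma leq_lcp n u v : n <= size u -> n <= size v ->
  take n u = take n v -> n <= lcp u v.
Proof.
elim: u v n => [|l u IH] [|l' v] [|n] //= Hu Hv [-> E].
by rewrite eqxx ltnS IH.
Qed.

Lemma lcp_ultra u v w : minn (lcp u v) (lcp u w) <= lcp v w.
Proof.
set n := minn _ _; have Hv : n <= lcp u v by apply: geq_minl.
have Hw : n <= lcp u w by apply: geq_minr.
apply: leq_lcp; first exact: leq_trans Hv (lcp_sizer _ _).
  exact: leq_trans Hw (lcp_sizer _ _).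
by rewrite -(take_lcp Hv) (take_lcp Hw).
Qed.

(** Cancellation removes exactly the common prefix. All lengths of products are computed from
    this. *)
Lemma mulVw_lcp u v : reduced u -> reduced v ->
  mulw (invw u) v = invw (drop (lcp u v) u) ++ drop (lcp u v) v.
Proof.
elim: u v => [|l u IH] [|l' v] //= Hu Hv; rewrite ?drop0 ?cats0.
  by rewrite mulw0 // invw_reduced.
have Ru : reduced u by apply: path_sorted Hu.
have Rv : reduced v by apply: path_sorted Hv.
case: eqP => [<- | /eqP ne].
  by rewrite invw_cons /mulw foldr_rcons /= linvK eqxx -/(mulw _ _) IH.
rewrite drop0 mulw_cat // invw_cons cat_rcons /reduced.
rewrite sorted_cat_cons -/(reduced (rcons (invw u) (linv l))) -invw_cons.
rewrite invw_reduced /=; apply/and3P; split=> //.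
by rewrite /noncancel linvK eq_sym.
Qed.

End Words.

(** * Free groups *)

Local Open Scope group_scope.

Section InCycle.
Variable F : groupType.
Implicit Types t x y : F.

(** An integer exponent is kept as a difference of natural ones, so that products and inverses need
    no case on signs. *)
Definition incyc t x := exists m n : nat, x = t ^+ m * t ^- n.

Lemma commute_expV t m n : commute (t ^- m) (t ^+ n).
Proof. by apply/commute_sym/commuteV; apply: commuteX2. Qed.

Lemma incyc1 t : incyc t 1.
Proof. by exists 0, 0; rewrite !expg0 invg1 mulg1. Qed.

Lemma incyc_id t : incyc t t.
Proof. by exists 1%N, 0; rewrite expg1 expg0 invg1 mulg1. Qed.

Lemma incycM t x y : incyc t x -> incyc t y -> incyc t (x * y).
Proof.
move=> [m [n ->]] [m' [n' ->]]; exists (m + m')%N, (n' + n)%N.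
rewrite !expgnDr invgM -!mulgA; congr (_ * _); rewrite !mulgA.
by rewrite commute_expV -!mulgA -!invgM -!expgnDr addnC.
Qed.

Lemma incycV t x : incyc t x -> incyc t x^-1.
Proof. by move=> [m [n ->]]; exists n, m; rewrite invgM invgK. Qed.

End InCycle.

Definition sg (F : groupType) (b : bool) (x : F) := if b then x else x^-1.

Lemma sgN (F : groupType) b (x : F) : sg (~~ b) x = (sg b x)^-1.
Proof. by case: b; rewrite /= ?invgK. Qed.

Section FreeGroup.
Variable T : finType.

Record fgroup := FGroup { fgval :> seq (T * bool); fgvalP : reduced fgval }.
Bind Scope group_scope with fgroup.
HB.instance Definition _ := [isSub for fgval].
HB.instance Definition _ := [Choice of fgroup by <:].


Definition fgone := FGroup (isT : reduced (Nil (T * bool))).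
Definition fginv (x : fgroup) := FGroup (etrans (invw_reduced x) (fgvalP x)).
Definition fgmul (x y : fgroup) := FGroup (mulw_reduced x (fgvalP y)).

Lemma fgmulA : associative fgmul.
Proof. by move=> x y z; apply: val_inj; rewrite /= mulwA ?fgvalP. Qed.
Lemma fgmul1 : left_id fgone fgmul.
Proof. by move=> x; apply: val_inj. Qed.
Lemma fgmulx1 : right_id fgone fgmul.
Proof. by move=> x; apply: val_inj; rewrite /= mulw0 ?fgvalP. Qed.
Lemma fgmulV : left_inverse fgone fginv fgmul.
Proof. by move=> x; apply: val_inj; rewrite /= mulVw ?fgvalP. Qed.
Lemma fgmulxV : right_inverse fgone fginv fgmul.
Proof.
by move=> x; apply: val_inj; rewrite /= -{1}[fgval x]invwK mulVw ?invw_reduced ?fgvalP.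
Qed.
HB.instance Definition _ :=
  isGroup.Build fgroup fgmulA fgmul1 fgmulx1 fgmulV fgmulxV.

Definition free_group : groupType := fgroup.
Local Notation FG := free_group.
Implicit Types x y z : FG.

Definition fgen (a : T) : FG := FGroup (isT : reduced [:: (a, true)]).

Definition fglen x := size (fgval x).
(* The Gromov product of the Cayley tree: the length of the common prefix. *)
Definition gp x y := lcp (fgval x) (fgval y).

Lemma fgvalM x y : fgval (x * y) = mulw x y. Proof. by []. Qed.
Lemma fgvalV x : fgval x^-1 = invw x. Proof. by []. Qed.

Lemma fglenV x : fglen x^-1 = fglen x.
Proof. by rewrite /fglen fgvalV size_invw. Qed.

Lemma fglen_eq0 x : (fglen x == 0) = (x == 1).
Proof.
rewrite /fglen size_eq0; apply/eqP/eqP => [E|->] //; exact: val_inj.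
Qed.

Lemma fglen_VM x y : (fglen (x^-1 * y) + (gp x y).*2 = fglen x + fglen y)%N.
Proof.
rewrite /fglen fgvalM fgvalV mulVw_lcp ?fgvalP // size_cat size_invw !size_drop.
rewrite /gp; move: (lcp_sizel x y) (lcp_sizer x y).
by move: (lcp _ _) (size _) (size _) => *; lia.
Qed.

Lemma gp_le x y : fglen y <= fglen (x^-1 * y) -> (gp x y).*2 <= fglen x.
Proof. by have := fglen_VM x y; lia. Qed.

Lemma gpC x y : gp x y = gp y x. Proof. exact: lcpC. Qed.

Lemma gp_ultra x y z : minn (gp x y) (gp x z) <= gp y z.
Proof. exact: lcp_ultra. Qed.

(** If x agreed with its inverse on half of its length, then the middle letter would be its own
    inverse (odd length), or the two middle letters would cancel (even length). *)
Lemma gpV_lt x : x != 1 -> (gp x x^-1).*2 < fglen x.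
Proof.
rewrite -fglen_eq0 /fglen => nz; rewrite ltnNge; apply/negP => H.
set w := fgval x in nz H; have Hx : reduced w := fgvalP x.
set h := uphalf (size w); have Hh : h <= gp x x^-1 by rewrite /h; lia.
have /(take_lcp) E : h <= lcp w (invw w) by [].
have h0 : 0 < h by rewrite /h; lia.
case Ew: {1}w => [|a0 w0]; first by rewrite Ew in nz.
have Hs : h.-1 < size w by rewrite /h; lia.
have : nth a0 w h.-1 = linv (nth a0 w (size w - h)).
  have := congr1 (fun s => nth a0 s h.-1) E; rewrite !nth_take ?prednK // => ->.
  rewrite /invw nth_rev size_map ?Hs // prednK // (nth_map a0) //.
  by rewrite /h; lia.
have [odd_w | even_w] := boolP (odd (size w)).
  have -> : (size w - h = h.-1)%N by rewrite /h; lia.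
  by move/eqP; rewrite linv_neq.
have Eh : (size w - h = h.-1.+1)%N by rewrite /h; lia.
rewrite Eh => E2; have : noncancel (nth a0 w h.-1) (nth a0 w h.-1.+1).
  by move/(sortedP a0): Hx; apply; rewrite /h; lia.
by rewrite /noncancel E2 linvK eqxx.
Qed.

(** Numeral form of Nielsen's order: it refines length, is invariant under inversion, and tells
    apart the two halves of a word of even length. *)
Definition wt x := (nu (fgval x) + nu (fgval x^-1))%N.

Lemma wtV x : wt x^-1 = wt x.
Proof. by rewrite /wt invgK addnC. Qed.

Lemma wt_sg b x : wt (sg b x) = wt x.
Proof. by case: b; rewrite /= ?wtV. Qed.

Lemma fglen_wt x y : wt x <= wt y -> fglen x <= fglen y.
Proof.
move=> H; rewrite leqNgt; apply/negP => lt_yx; move: H; rewrite leqNgt => /negP[].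
by rewrite /wt -addSn leq_add ?nu_size // ltnW // nu_size // !fgvalV !size_invw.
Qed.

(* Writing x^-1 = p q^-1 and z = q s, the product x^-1 z = p s has the length of
   z; its weight is smaller, as the change of the leading half q into p outweighs
   the change of the trailing half of the inverse. *)
Lemma wt_exchange x z h :
    gp x z = h -> fglen x = h.*2 -> h.*2 <= fglen z ->
    nu (take h (fgval x^-1)) < nu (take h (fgval x)) ->
  wt (x^-1 * z) < wt z.
Proof.
move=> Eh Ex Hz; set p := take h _; set q := take h _ => Hpq.
set s := drop h (fgval z).
have Ez : fgval z = q ++ s.
  rewrite -[LHS](cat_take_drop h); congr (_ ++ _); apply: esym.
  by apply: take_lcp; rewrite -Eh.
have Exz : fgval (x^-1 * z) = p ++ s.
  rewrite fgvalM fgvalV mulVw_lcp ?fgvalP // -/(gp x z) Eh; congr (_ ++ _).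
  rewrite /p fgvalV /invw take_rev size_map -map_drop.
  by congr (rev (map _ (drop _ _))); move: Ex; rewrite /fglen; lia.
have Sp : size p = h.
  by rewrite size_takel // fgvalV size_invw -/(fglen x) Ex; lia.
have Sq : size q = h by rewrite size_takel // -/(fglen x) Ex; lia.
have Ss : h <= size s by rewrite size_drop -/(fglen z); lia.
rewrite /wt !fgvalV Exz Ez /invw !map_cat !rev_cat !nu_cat.
rewrite !size_rev !size_map Sp Sq.
have := nu_lt (rev (map (@linv T) p)); rewrite size_rev size_map Sp.
move: (nu (rev (map (@linv T) p))) (nu (rev (map (@linv T) q))) => a b Ha.
have Hb : #|{: T * bool}|.+1 ^ h <= #|{: T * bool}|.+1 ^ size s.
  by rewrite leq_pexp2l.
set B1 := (_ ^ h)%N in Ha Hb *; set B2 := (_ ^ size s)%N in Hb *.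
have : ((nu p).+1 * B2 <= nu q * B2)%N by rewrite leq_mul2r Hpq orbT.
by rewrite mulSn; lia.
Qed.

End FreeGroup.

(** * Nielsen reduction *)

Definition upd (I : eqType) (A : Type) (g : I -> A) j x : I -> A :=
  fun k => if k == j then x else g k.

Section WordValue.
Variables (F : groupType) (I : finType) (g : I -> F).

Definition lval (a : I * bool) : F := sg a.2 (g a.1).
Definition wval (s : seq (I * bool)) : F := foldr (fun a x => lval a * x) 1 s.

Lemma lval_linv a : lval (linv a) = (lval a)^-1.
Proof. exact: sgN. Qed.

Lemma wval_lact a s : wval (lact a s) = lval a * wval s.
Proof.
case: s => [|b s] //=; case: eqP => [->|] //=.
by rewrite lval_linv mulVKg.
Qed.

(** Irreducible tuples may have trivial entries. Their letters are dropped here, so that the length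
    estimates apply to what remains. *)
Lemma wval_reduced s :
  exists s', [/\ reduced s', all (fun a => lval a != 1) s' & wval s' = wval s].
Proof.
elim: s => [|a s [s' [R A E]]]; first by exists [::].
have [a1 | a1] := eqVneq (lval a) 1; first by exists s'; rewrite /= a1 mul1g.
exists (lact a s'); split; first exact: lact_reduced.
  case: s' A {R E} => [|b s'] /= => [|/andP[b1 A]]; first by rewrite a1.
  by case: eqP => //= _; rewrite a1 b1 A.
by rewrite wval_lact /= E.
Qed.

Lemma wval_cat s1 s2 : wval (s1 ++ s2) = wval s1 * wval s2.
Proof. by elim: s1 => [|a s IH] /=; rewrite ?mul1g // IH mulgA. Qed.

Lemma wval_invw s : wval (invw s) = (wval s)^-1.
Proof.
elim: s => [|a s IH] /=; first by rewrite invg1.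
by rewrite invw_cons -cats1 wval_cat IH /= mulg1 lval_linv -invgM.
Qed.
End WordValue.

Section Nielsen.
Variables (T I : finType).
Local Notation F := (free_group T).
Implicit Types (g : I -> F).

Definition irreducible_tuple g := [forall i, forall j, forall e, forall d,
  (i != j) ==> (wt (g j) <= wt (sg e (g i) * sg d (g j)))].

(** Termination by total weight, packed as an induction principle: a property is pulled back through
    one elementary move at a time, and the composite of the moves never has to be recorded. *)
Lemma nielsen_ind (Q : (I -> F) -> Prop) :
    (forall g i j e, i != j -> Q (upd g j (sg e (g i) * g j)) -> Q g) ->
    (forall g i j e, i != j -> Q (upd g j (g j * sg e (g i))) -> Q g) ->
    (forall g, irreducible_tuple g -> Q g) ->
  forall g, Q g.
Proof.
move=> QL QR Qi g; have [n] := ubnP (\sum_i wt (g i)).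
elim: n g => // n IH g; rewrite ltnS => Hn.
have step j x : wt x < wt (g j) -> Q (upd g j x).
  move=> lt_x; apply: IH; apply: leq_trans Hn.
  rewrite (bigD1 j) // [ltnRHS](bigD1 j) //= /upd eqxx.
  rewrite -addSn; apply: leq_add => //; apply: eq_leq; apply: eq_bigr => k.
  by move/negbTE->.
have [/Qi//|] := boolP (irreducible_tuple g).
case/forallPn=> i /forallPn[j] /forallPn[e] /forallPn[d].
rewrite negb_imply -ltnNge => /andP[nij]; case: d => /= lt_wt.
  by apply: (QL _ i j e) => //; apply: step.
(* The inverse of [sg e (g i) * (g j)^-1] is a right move on [g j], and has the same weight. *)
apply: (QR _ i j (~~ e)) => //; apply: step.
by rewrite sgN -wtV invgM invgK.
Qed.

Section Irreducible.
Variable g : I -> F.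
Hypothesis irr_g : irreducible_tuple g.
Local Notation u := (lval g).
Implicit Types a b : I * bool.

Lemma wt_irr a b : a.1 != b.1 -> wt (u b) <= wt (u a * u b).
Proof.
move=> ne; have /forallP/(_ a.1)/forallP/(_ b.1)/forallP/(_ a.2) := irr_g.
by move/forallP/(_ b.2)/implyP/(_ ne); rewrite /lval wt_sg.
Qed.

(** Otherwise the product with the inverse letter would be shorter than its other factor, against
    irreducibility; for equal indices the two letters are mutually inverse and [gpV_lt] applies. *)
Lemma gp_half a b : b != a -> u b != 1 -> (gp (u a) (u b)).*2 <= fglen (u b).
Proof.
move=> ne b1; have [Eab | nab] := eqVneq a.1 b.1.
  by rewrite (eq_linv Eab) 1?eq_sym // lval_linv gpC ltnW // gpV_lt.
have nba : (linv b).1 != a.1 by rewrite eq_sym.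
rewrite gpC gp_le // -lval_linv; apply: fglen_wt; exact: wt_irr.
Qed.

(** What b loses to its two neighbours does not exhaust it. Each loss is at most half, so the only
    danger is u b = p q^-1 with u a starting with p, u d starting with q, and p, q of equal length.
    If p is the smaller, multiplying u d by u b replaces q by p and lowers the weight; if q is,
    multiplying u a by the inverse does. If p = q, then u b is trivial by [gpV_lt]. *)
Lemma gp_pair a b d : a != b -> d != linv b -> u a != 1 -> u b != 1 -> u d != 1 ->
  gp (u a) (u b) + gp (u (linv b)) (u d) < fglen (u b).
Proof.
move=> nab ndb a1 b1 d1; rewrite ltnNge; apply/negP => ge_b.
have Vb1 : u (linv b) != 1 by rewrite lval_linv invg_eq1.
have Ha : (gp (u a) (u b)).*2 <= fglen (u b) by rewrite gp_half // eq_sym.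
have Ha' : (gp (u a) (u b)).*2 <= fglen (u a) by rewrite gpC gp_half.
have Hd : (gp (u (linv b)) (u d)).*2 <= fglen (u d) by rewrite gp_half.
have Hd' : (gp (u (linv b)) (u d)).*2 <= fglen (u b).
  by rewrite gpC -(fglenV (u b)) -lval_linv gp_half // eq_sym.
have Vlt := gpV_lt b1.
have nab1 : a.1 != b.1.
  apply: contraNneq nab => Eab; apply/eqP.
  have [//|nab] := eqVneq a b.
  by move: Vlt Ha Hd' ge_b; rewrite (eq_linv Eab nab) lval_linv gpC; clear; lia.
have ndb1 : d.1 != b.1.
  apply: contraNneq ndb => Edb; apply/eqP.
  have [Ed|nd] := eqVneq d b.
    by move: Vlt Ha Hd' ge_b; rewrite Ed lval_linv [gp _^-1 _]gpC; clear; lia.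
  exact: eq_linv.
set h := gp (u a) (u b).
have [Eh Eb] : gp (u (linv b)) (u d) = h /\ fglen (u b) = h.*2.
  by move: Ha Hd' ge_b; rewrite -/h; clear; lia.
have [lt_pq | lt_qp | E] := ltngtP (nu (take h (fgval (u b)))) (nu (take h (fgval (u b)^-1))).
- have := @wt_irr b d; rewrite eq_sym leqNgt => /(_ ndb1) /negP[].
  rewrite -[u b]invgK; apply: (@wt_exchange _ _ _ h).
  + by rewrite -lval_linv.
  + by rewrite fglenV.
  + by rewrite -Eh.
  + by rewrite invgK.
- have := @wt_irr (linv b) a; rewrite eq_sym leqNgt => /(_ nab1) /negP[].
  rewrite lval_linv; apply: (@wt_exchange _ _ _ h) => //.
  by rewrite gpC.
have /nu_inj Et := E.
suff : h <= gp (u b) (u b)^-1 by move: Vlt; rewrite Eb; clear; lia.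
by apply: leq_lcp => //; rewrite -/(fglen _) ?fglenV Eb -addnn leq_addr.
Qed.

Definition next_gp a s := if s is b :: _ then gp (u (linv a)) (u b) else 0.

(* By [gp_pair] less than all of each letter cancels, so by [gp_ultra] the product
   starts like its first letter. *)
Lemma irr_word a s : reduced (a :: s) -> all (fun b => u b != 1) (a :: s) ->
  (forall b, b != a -> u b != 1 -> gp (u b) (wval g (a :: s)) = gp (u b) (u a)) /\
  size s + fglen (u a) <= fglen (wval g (a :: s)) + next_gp a s.
Proof.
elim: s a => [|a' s IH] a; first by rewrite /= mulg1 andbT add0n addn0.
move=> Hr Ha; have /andP[nc Hr'] : noncancel a a' && reduced (a' :: s) := Hr.
have /andP[a1 Ha'] : (u a != 1) && all (fun b => u b != 1) (a' :: s) := Ha.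
have a1' : u a' != 1 by case/andP: Ha'.
have [IH1 IH2] := IH a' Hr' Ha'; set w' := wval g (a' :: s) in IH1 IH2.
have -> : wval g [:: a, a' & s] = u a * w' by [].
set c := gp (u (linv a)) (u a').
have Ec : gp (u (linv a)) w' = c.
  by apply: IH1; [rewrite eq_sym | rewrite lval_linv invg_eq1].
have El : (fglen (u a * w') + c.*2 = fglen (u a) + fglen w')%N.
  by rewrite -Ec lval_linv -(fglenV (u a)) -fglen_VM invgK.
have Eg : (gp (u a * w') (u a) + c = fglen (u a))%N.
  have := fglen_VM (u a * w') (u a); rewrite invgM mulgVK fglenV.
  by move: El; move: (fglen (u a * w')) => *; lia.
split=> [b nba b1|].
  have lt_b : gp (u b) (u a) + c < fglen (u a) by rewrite gp_pair.
  have := gp_ultra (u a) (u b) (u a * w'); have := gp_ultra (u a * w') (u a) (u b).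
  rewrite (gpC (u a * w') (u b)) (gpC (u a) (u b)) (gpC (u a) (u a * w')).
  by move: lt_b Eg; clear; lia.
have lt_a' : (c + next_gp a' s < fglen (u a'))%N.
  case: s Hr' Ha' {IH IH1 IH2 Hr Ha w' Ec El Eg} => [|a2 s] /=.
    have := @gp_half (linv a) a' nc a1'; rewrite addn0 -/c.
    by have := fglen_eq0 (u a'); rewrite (negbTE a1'); lia.
  move=> /andP[nc' _] /and3P[_ a21 _]; apply: gp_pair => //.
    by rewrite eq_sym.
  by rewrite lval_linv invg_eq1.
by rewrite /= -/c; lia.
Qed.

(** Every factor keeps at least one uncancelled letter. Hence nonempty reduced words in nontrivial
    entries are nontrivial, and a product of length 1 has a single factor. *)
Lemma irr_word_size s : reduced s -> all (fun b => u b != 1) s ->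
  size s <= fglen (wval g s).
Proof.
case: s => // a s Hr Ha; have [_] := irr_word Hr Ha.
suff : next_gp a s < fglen (u a) by rewrite [size (a :: s)]/=; lia.
have /andP[a1 Ha'] := Ha; have := fglen_eq0 (u a); rewrite (negbTE a1).
case: s Hr Ha' {Ha} => [|a' s] /=; first by lia.
move=> /andP[nc _] /andP[a1' _].
rewrite gpC -(fglenV (u a)) -lval_linv.
have := @gp_half a' (linv a); rewrite lval_linv invg_eq1 a1 eq_sym.
by move=> /(_ nc isT); rewrite fglenV; lia.
Qed.

Lemma irr_gen x s : wval g s = x -> fglen x = 1%N -> exists a, u a = x.
Proof.
move=> <- Hx; have [s' [R A E]] := wval_reduced g s.
have := irr_word_size R A; rewrite E Hx.
case: s' R A E => [|a [|b s']] //= _ _ E _; last by exists a; rewrite -E mulg1.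
by move: Hx; rewrite -E.
Qed.

End Irreducible.
End Nielsen.

(** Nielsen moves preserve commutation of the pair, and a cyclic group containing the new pair
    contains the old one. In an irreducible pair some entry is trivial: otherwise the commutator
    would be a reduced word of four letters with value 1. *)
Lemma commute_incyc (T : finType) (x y : (free_group T)) :
  commute x y -> exists z, incyc z x /\ incyc z y.
Proof.
move=> Cxy; pose g b := if b then x else y.
suff /(_ g Cxy) : forall g : bool -> (free_group T), commute (g true) (g false) ->
  exists z, incyc z (g true) /\ incyc z (g false) by [].
have cyc_sg e (z t : (free_group T)) : incyc z t -> incyc z (sg e t).
  by case: e => //; apply: incycV.
have main i j (f f' : bool -> (free_group T)) :
   i != j -> f' i = f i -> commute (f i) (f' j) ->
   (forall z, incyc z (f i) -> incyc z (f' j) -> incyc z (f j)) ->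
   (commute (f' true) (f' false) -> exists z, incyc z (f' true) /\ incyc z (f' false)) ->
   exists z, incyc z (f true) /\ incyc z (f false).
  case: i j => [] [] //= _ Ei C H IHf.
    have [|z [z1 z2]] := IHf; first by rewrite Ei.
    by rewrite Ei in z1; exists z; split=> //; apply: H.
  have [|z [z1 z2]] := IHf; first by rewrite Ei; apply: commute_sym.
  by rewrite Ei in z2; exists z; split=> //; apply: H.
apply: nielsen_ind => {g Cxy x y}[g i j e nij IHg|g i j e nij IHg|g irr C].
- move=> C; have Cij : commute (g i) (g j).
    by case: i j nij {IHg} => [] [] // _; apply: commute_sym.
  apply: main (nij) _ _ _ IHg; rewrite /upd ?eqxx ?(negbTE nij) //.
    apply: commuteM => //; case: e => //=; apply: commuteV; exact: commute_refl.
  move=> z zi zj; rewrite -[g j](mulKg (sg e (g i))).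
  by apply: incycM => //; apply: incycV; apply: cyc_sg.
- move=> C; have Cij : commute (g i) (g j).
    by case: i j nij {IHg} => [] [] // _; apply: commute_sym.
  apply: main (nij) _ _ _ IHg; rewrite /upd ?eqxx ?(negbTE nij) //.
    apply: commuteM => //; case: e => //=; apply: commuteV; exact: commute_refl.
  move=> z zi zj; rewrite -[g j](mulgK (sg e (g i))).
  by apply: incycM => //; apply: incycV; apply: cyc_sg.
have [t1|t1] := eqVneq (g true) 1.
  by exists (g false); rewrite t1; split; [apply: incyc1 | apply: incyc_id].
have [f1|f1] := eqVneq (g false) 1.
  by exists (g true); rewrite f1; split; [apply: incyc_id | apply: incyc1].
have := @irr_word_size _ _ g irr [:: (true, true); (false, true); (true, false); (false, false)].
rewrite /= /lval /= !invg_eq1 t1 f1 mulg1 => /(_ isT isT).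
by rewrite -invgM -C mulgA mulgV.
Qed.

(** * The Magnus ordering *)

Import Order.TTheory GRing.Theory Num.Theory.
Local Open Scope ring_scope.

Section Magnus.
Variable T : finType.
Local Notation F := (free_group T).
Local Notation series := (seq T -> int).
Implicit Types (a b : series) (w u v : seq T) (x y z : F).

Definition alternating w := sorted (fun s t : T => s != t) w.

(* Magnus embedding t |-> 1 + X_t into the series with X_t ^ 2 = 0: a series is
   a function on words, of which only the values at alternating words matter. *)
Definition lsign (l : T * bool) : int := if l.2 then 1 else -1.
Definition mact (l : T * bool) a : series := fun w =>
  if w is t :: w' then a w + (if t == l.1 then lsign l * a w' else 0) else a w.
Definition mone : series := fun w => (w == [::])%:R.
Definition mu (s : seq (T * bool)) : series := foldr mact mone s.

(** The product of noncommutative series, summed over the splittings of w. Prefixes and suffixes of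
    an alternating word are alternating, so the values there depend only on values at alternating
    words. *)
Fixpoint conv a b w : int :=
  if w is t :: w' then a [::] * b w + conv (fun v => a (t :: v)) b w'
  else a [::] * b [::].

Lemma alternating_catl u v : alternating (u ++ v) -> alternating u.
Proof. by rewrite /alternating => /cat_sorted2[]. Qed.

Lemma alternating_catr u v : alternating (u ++ v) -> alternating v.
Proof. by rewrite /alternating => /cat_sorted2[]. Qed.

Lemma alternating_cons t w : alternating (t :: w) -> alternating w.
Proof. exact: path_sorted. Qed.

Lemma lsign_sq l : lsign l * lsign l = 1.
Proof. by case: l => t []. Qed.

Lemma lsign_linv l : lsign (linv l) = - lsign l.
Proof. by case: l => t []. Qed.

Lemma mact_eq l a b : (forall w, alternating w -> a w = b w) ->
  forall w, alternating w -> mact l a w = mact l b w.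
Proof.
move=> E [|t w] Hw /=; first exact: E.
by rewrite !E //; apply: alternating_cons Hw.
Qed.

(** This is (1 + X) (1 - X) = 1 - X^2: the quadratic term would need two equal neighbours, which an
    alternating word does not have. *)
Lemma mactK l a w : alternating w -> mact (linv l) (mact l a) w = a w.
Proof.
case: w => [|t w] //= Hw; case: eqP => [Et|_]; rewrite ?addr0 // lsign_linv.
rewrite -addrA -[RHS]addr0; congr (_ + _); rewrite mulNr.
suff -> : mact l a w = a w by rewrite subrr.
case: w Hw => [|t' w] //= /andP[/negbTE]; rewrite Et eq_sym => ->.
by rewrite addr0.
Qed.

Lemma foldr_mact_lact a l s : 
  forall w, alternating w ->
  foldr mact a (lact l s) w = mact l (foldr mact a s) w.
Proof.
case: s => [|l' s] //= w Hw; case: eqP => [->|] //=.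
have := mactK (linv l) (foldr mact a s) Hw; rewrite linvK => <-.
by [].
Qed.

Lemma mu_mulw s s' w : alternating w -> mu (mulw s s') w = foldr mact (mu s') s w.
Proof.
elim: s w => [|l s IH] w Hw //=.
by rewrite /mu foldr_mact_lact //; apply: mact_eq.
Qed.

Lemma eq_conv_l a a' b w : a =1 a' -> conv a b w = conv a' b w.
Proof.
elim: w a a' => [|t w IH] a a' E /=; first by rewrite E.
by rewrite E (IH _ (fun v => a' (t :: v))) // => v; apply: E.
Qed.

Lemma conv_linl a a' b e w :
  conv (fun v => a v + e * a' v) b w = conv a b w + e * conv a' b w.
Proof.
elim: w a a' => [|t w IH] a a' /=; first by rewrite mulrDl mulrA.
rewrite (IH (fun v => a (t :: v)) (fun v => a' (t :: v))).
by rewrite mulrDl mulrDr mulrA addrACA.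
Qed.

Lemma conv_mact l a b w : conv (mact l a) b w = mact l (conv a b) w.
Proof.
case: w => [|t w] //=; rewrite -addrA; congr (_ + _).
case: eqP => _; last first.
  by rewrite addr0; apply: eq_conv_l => v; rewrite addr0.
exact: conv_linl.
Qed.

Lemma conv_mone b w : conv mone b w = b w.
Proof.
case: w => [|t w] /=; rewrite mul1r // -[RHS]addr0; congr (_ + _).
have -> : (fun v => mone (t :: v)) = (fun _ => 0) by [].
elim: w => [|t' w IH] /=; rewrite mul0r //.
by rewrite IH.
Qed.

Lemma conv_foldr s b w : conv (mu s) b w = foldr mact b s w.
Proof.
elim: s w => [|l s IH] w /=; first exact: conv_mone.
by rewrite conv_mact /mact; case: w => [|t w]; rewrite !IH.
Qed.

Lemma mu_nil s : mu s [::] = 1.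
Proof. by elim: s. Qed.

Lemma eq_conv_r a b b' w : (forall u v, w = u ++ v -> b v = b' v) ->
  conv a b w = conv a b' w.
Proof.
elim: w a => [|t w IH] a H /=; first by rewrite (H [::] [::]).
rewrite (H [::] (t :: w)) // IH // => u v E.
by apply: (H (t :: u)); rewrite E.
Qed.

(** As the constant term of a Magnus series is 1, multiplication leaves the first difference of two
    series in its place with its sign. This and its mirror image make the order invariant on both
    sides. *)
Lemma conv_subr a b b' w : (forall u v, w = u ++ v -> u != [::] -> b v = b' v) ->
  conv a b w - conv a b' w = a [::] * (b w - b' w).
Proof.
case: w => [|t w] H /=; first by rewrite mulrBr.
rewrite (@eq_conv_r _ b b') => [|u v E]; last by apply: (H (t :: u)); rewrite ?E.
by rewrite opprD addrACA subrr addr0 mulrBr.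
Qed.

Lemma conv_subl a a' b w : (forall u v, w = u ++ v -> v != [::] -> a u = a' u) ->
  conv a b w - conv a' b w = (a w - a' w) * b [::].
Proof.
elim: w a a' => [|t w IH] a a' H /=; first by rewrite mulrBl.
rewrite (H [::] (t :: w)) // opprD addrACA subrr add0r IH // => u v E.
by apply: (H (t :: u) v); rewrite E.
Qed.

Definition magnus x : series := mu (fgval x).

Lemma magnusM x y w : alternating w ->
  magnus (x * y)%g w = conv (magnus x) (magnus y) w.
Proof. by move=> Hw; rewrite /magnus mu_mulw // conv_foldr. Qed.

Lemma magnus_nil x : magnus x [::] = 1. Proof. exact: mu_nil. Qed.

Fixpoint syllables (s : seq (T * bool)) : seq T :=
  if s is l :: s' then
    if ohead (syllables s') == Some l.1 then syllables s' else l.1 :: syllables s'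
  else [::].

Lemma mu_cons l s t w : mu (l :: s) (t :: w) =
  mu s (t :: w) + (if t == l.1 then lsign l * mu s w else 0).
Proof. by []. Qed.

(* The coefficient at the sequence of the syllables of s is the product of their
   exponents; the last clause is what an induction on letters can carry. *)
Lemma mu_syllables s : reduced s ->
  [/\ alternating (syllables s),
      forall w, alternating w -> ~~ subseq w (syllables s) -> mu s w = 0 &
      if s is l :: _ then exists2 s', syllables s = l.1 :: s' &
        0 < lsign l * mu s (l.1 :: s') * mu s s' else True].
Proof.
elim: s => [|l s IH] Hs; first by split=> // -[].
have {}IH := IH (path_sorted Hs).
have mu0 w : ohead w != Some l.1 -> mu (l :: s) w = mu s w.
  by case: w => [|t w] //= ne; rewrite ifN ?addr0.
have alt_head w : alternating (l.1 :: w) -> ohead w != Some l.1.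
  by case: w => [|t w] //= /andP[ne _]; rewrite eq_sym; apply: contraNneq ne => -[->].
have [Ehd | nhd] := eqVneq (ohead (syllables s)) (Some l.1).
  have Esyl : syllables (l :: s) = syllables s by rewrite /= Ehd eqxx.
  rewrite Esyl; case: s Hs IH mu0 Ehd Esyl => [|l' s] //.
  move=> /andP[nc Hs] [Halt V [s' Es' pos]] mu0; rewrite Es' => -[El] Esyl.
  rewrite Es' in Halt V; have Hs' : ohead s' != Some l.1.
    by apply: alt_head; rewrite -El.
  have Ell : l' = l by apply: contraNeq nc => /(eq_linv El)->.
  rewrite {}Ell in Halt V pos mu0 * => {l' El nc Hs Es' Esyl}; split=> //.
  - move=> [|t w] Hw nsub; first by rewrite sub0seq in nsub.
    rewrite mu_cons V // add0r; case: eqP => // Et.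
    rewrite V ?mulr0 //; first exact: alternating_cons Hw.
    apply: contra nsub; rewrite Et; have {Et Hw} : ohead w != Some l.1.
      by apply: alt_head; rewrite -Et.
    case: w => [|t' w] /=; first by rewrite eqxx sub0seq.
    move=> ne; have /negbTE-> : t' != l.1 by apply: contraNneq ne => ->.
    by rewrite eqxx.
  - exists s' => //; rewrite (mu0 s') //.
    have -> : mu [:: l, l & s] (l.1 :: s') =
        mu (l :: s) (l.1 :: s') + lsign l * mu (l :: s) s' by rewrite mu_cons eqxx.
    rewrite mulrDr mulrA lsign_sq mul1r mulrDl ltr_wpDr // -expr2.
    exact: sqr_ge0.
have Esyl : syllables (l :: s) = l.1 :: syllables s by rewrite /= (negbTE nhd).
case: IH => Halt V pos; rewrite Esyl; split.
- rewrite /alternating; case: (syllables s) Halt nhd => [|t w] //= Halt ne.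
  by rewrite [path _ _ _]Halt andbT eq_sym.
- move=> [|t w] Hw nsub; first by rewrite sub0seq in nsub.
  rewrite mu_cons V ?add0r //.
    case: eqP nsub => // -> nsub; rewrite V ?mulr0 //.
      exact: alternating_cons Hw.
    by move: nsub; rewrite /= eqxx.
  apply: contra nsub => nsub; apply: subseq_trans nsub _; exact: subseq_cons.
exists (syllables s) => //; rewrite (mu0 (syllables s)) //.
have -> : mu (l :: s) (l.1 :: syllables s) = lsign l * mu s (syllables s).
  rewrite mu_cons eqxx V ?add0r //.
    rewrite /alternating; case: (syllables s) Halt nhd => [|t w] //= Halt ne.
    by rewrite [path _ _ _]Halt andbT eq_sym.
  by apply/negP => /size_subseq; rewrite /= ltnn.
rewrite mulrA lsign_sq mul1r -expr2 lt0r sqr_ge0 andbT expf_neq0 //.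
case: s pos {mu0 Esyl V Halt nhd Hs} => [|l' s] => [_|[s' Es' pos]].
  by rewrite mu_nil.
by rewrite Es'; apply: contraTneq pos => ->; rewrite mulr0 mul0r ltxx.
Qed.

Lemma magnus_neq1 x : x != 1%g -> exists2 w, alternating w & magnus x w != mone w.
Proof.
move=> x1; have [Halt _] := mu_syllables (fgvalP x).
rewrite /magnus; case E: (fgval x) => [|l s].
  by case/eqP: x1; apply: val_inj.
rewrite -E => -[s' Es' pos]; exists (syllables (fgval x)) => //.
rewrite Es' /mone; apply: contraTneq pos => ->.
by rewrite mulr0 mul0r ltxx.
Qed.

Lemma magnus_inj x y : (forall w, alternating w -> magnus x w = magnus y w) -> x = y.
Proof.
move=> E; apply/eqP; rewrite -[x == y]negbK; apply/negP => nxy.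
have [|w Hw /eqP[]] := @magnus_neq1 (x * y^-1)%g; first by rewrite divg_eq1.
transitivity (magnus (y * y^-1)%g w); last by rewrite mulgV.
rewrite !magnusM //; apply/eqP; rewrite -subr_eq0 conv_subl.
  by rewrite E // subrr mul0r.
by move=> u v Ew _; apply: E; rewrite Ew in Hw; apply: alternating_catl Hw.
Qed.

(** The Magnus bi-order: expansions are compared at the first alternating word, in the order of
    [nu], where they differ. *)
Definition glt x y := exists w, [/\ alternating w, magnus x w < magnus y w &
  forall u, alternating u -> (nu u < nu w)%N -> magnus x u = magnus y u].

Lemma glt_irr x : ~ glt x x.
Proof. by case=> w [_]; rewrite ltxx. Qed.

Lemma glt_trans x y z : glt x y -> glt y z -> glt x z.
Proof.
move=> [w [Hw lt_w E]] [w' [Hw' lt_w' E']].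
have [lt_ww' | lt_w'w | /nu_inj Eww'] := ltngtP (nu w) (nu w').
- exists w; split=> // [|u Hu lt_u]; first by rewrite -E'.
  by rewrite E // E' // (ltn_trans lt_u).
- exists w'; split=> // [|u Hu lt_u]; first by rewrite E.
  by rewrite E ?E' // (ltn_trans lt_u).
exists w; split=> // [|u Hu lt_u]; first by apply: lt_trans lt_w _; rewrite Eww'.
by rewrite E // E' // -Eww'.
Qed.

Lemma glt_total x y : x != y -> glt x y \/ glt y x.
Proof.
move=> /eqP nxy; have [n] : exists n, exists2 w, alternating w &
    nu w = n /\ magnus x w != magnus y w.
  apply: boolp.contrapT => H; apply: nxy; apply: magnus_inj => w Hw; apply/eqP.
  rewrite -[_ == _]negbK; apply/negP => ne; apply: H.
  by exists (nu w), w.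
elim/ltn_ind: n => n IH [w Hw [En ne]].
have [[u [Hu lt_u ne_u]] | H] := boolp.pselect (exists u,
  [/\ alternating u, (nu u < nu w)%N & magnus x u != magnus y u]).
  by apply: (IH (nu u)); [rewrite -En | exists u].
have E u : alternating u -> (nu u < nu w)%N -> magnus x u = magnus y u.
  move=> Hu lt_u; apply/eqP; rewrite -[_ == _]negbK; apply/negP => ne_u.
  by apply: H; exists u.
case: (ltgtP (magnus x w) (magnus y w)) ne => // lt_w _; [left|right].
  by exists w.
by exists w; split=> // u Hu lt_u; rewrite E.
Qed.

Lemma nu_catl u v : v != [::] -> (nu u < nu (u ++ v))%N.
Proof.
move=> nv; apply: nu_size; rewrite size_cat -[X in (X < _)%N]addn0 ltn_add2l.
by rewrite lt0n size_eq0.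
Qed.

Lemma nu_catr u v : u != [::] -> (nu v < nu (u ++ v))%N.
Proof.
move=> nv; apply: nu_size; rewrite size_cat -[X in (X < _)%N]add0n ltn_add2r.
by rewrite lt0n size_eq0.
Qed.

Lemma glt_mull z x y : glt x y -> glt (z * x)%g (z * y)%g.
Proof.
move=> [w [Hw lt_w E]]; exists w; split=> //.
  rewrite !magnusM // -subr_gt0 conv_subr ?magnus_nil ?mul1r ?subr_gt0 //.
  move=> u v Ew nu0; apply/esym/E; last by rewrite Ew nu_catr.
  by rewrite Ew in Hw; apply: alternating_catr Hw.
move=> w' Hw' lt_w'; rewrite !magnusM //; apply: eq_conv_r => u v Ew.
apply: E; first by rewrite Ew in Hw'; apply: alternating_catr Hw'.
apply: leq_ltn_trans lt_w'; rewrite Ew.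
by have [->|nz] := eqVneq u [::]; rewrite // ltnW // nu_catr.
Qed.

Lemma glt_mulr z x y : glt x y -> glt (x * z)%g (y * z)%g.
Proof.
move=> [w [Hw lt_w E]]; exists w; split=> //.
  rewrite !magnusM // -subr_gt0 conv_subl ?magnus_nil ?mulr1 ?subr_gt0 //.
  move=> u v Ew nv0; apply/esym/E; last by rewrite Ew nu_catl.
  by rewrite Ew in Hw; apply: alternating_catl Hw.
move=> w' Hw' lt_w'; rewrite !magnusM //; apply/eqP; rewrite -subr_eq0.
rewrite conv_subl ?E ?subrr ?mul0r // => u v Ew nv0.
apply: E; first by rewrite Ew in Hw'; apply: alternating_catl Hw'.
by apply: ltn_trans lt_w'; rewrite Ew nu_catl.
Qed.

End Magnus.

(** * Group rings *)

Section LinearExtension.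
Variables (k : fieldType) (K : choiceType) (V : lmodType k) (f : K -> V).
Implicit Types a b : {malg k[K]}.

Definition lin a : V := \sum_(x <- msupp a) a@_x *: f x.

Lemma linEw a (D : {fset K}) : (msupp a `<=` D)%fset ->
  lin a = \sum_(x <- D) a@_x *: f x.
Proof.
move=> sD; apply: big_fset_incl sD _ => x _ /mcoeff_outdom ->.
exact: scale0r.
Qed.

Lemma lin_is_linear : linear lin.
Proof.
move=> c a b; have sa := fsubsetUl (msupp a) (msupp b).
have sb := fsubsetUr (msupp a) (msupp b).
rewrite (linEw sa) (linEw sb) (@linEw _ (msupp a `|` msupp b)%fset).
  rewrite scaler_sumr -big_split; apply: eq_bigr => x _ /=.
  by rewrite mcoeffD mcoeffZ scalerDl scalerA.
apply/fsubsetP => x; rewrite -mcoeff_neq0 mcoeffD mcoeffZ in_fsetU.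
by case: (msuppP a); case: (msuppP b); rewrite //= mulr0 addr0 eqxx.
Qed.
HB.instance Definition _ := GRing.isLinear.Build k {malg k[K]} V _ lin lin_is_linear.

Lemma linU c x : lin << c *g x >> = c *: f x.
Proof. by rewrite (@linEw _ [fset x]%fset) ?msuppU_le // big_seq_fset1 mcoeffUU. Qed.
End LinearExtension.

Section GroupRing.
Variables (k : fieldType) (F : groupType).

Definition gring := {malg k[F]}.
HB.instance Definition _ := GRing.Lmodule.on gring.
Local Notation R := gring.

Implicit Types (a b c : R) (x y z : F).

Definition cf x a : k := a@_x.
(* [gr] and the product are locked, as unification would otherwise unfold formal sums. *)
Fact gring_key : unit. Proof. exact: tt. Qed.
Definition gr : F -> R := locked_with gring_key (fun x => << 1 *g x >>).

Lemma gr_def x : gr x = << 1 *g x >>.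
Proof. by rewrite /gr locked_withE. Qed.

Lemma cf_gr x y : cf y (gr x) = (x == y)%:R.
Proof. by rewrite /cf gr_def mcoeffU. Qed.

Lemma cfP a b : (forall x, cf x a = cf x b) -> a = b.
Proof. by move/malgP. Qed.

Lemma cf_is_scalar x : scalar (cf x).
Proof. by move=> c a b; rewrite /cf mcoeffD mcoeffZ. Qed.
HB.instance Definition _ x := GRing.isLinear.Build k R k _ (cf x) (cf_is_scalar x).

Lemma grE a : a = \sum_(x <- msupp a) cf x a *: gr x.
Proof.
rewrite {1}[a]monalgE; apply: eq_bigr => x _.
by apply/malgP => y; rewrite gr_def mcoeffZ !mcoeffU mulrnAr mulr1.
Qed.

Lemma lin_gr (V : lmodType k) (f : F -> V) x : lin f (gr x) = f x.
Proof. by rewrite gr_def linU scale1r. Qed.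

Lemma eq_lin (V : lmodType k) (f g : F -> V) a : f =1 g -> lin f a = lin g a.
Proof. by move=> E; apply: eq_bigr => x _; rewrite E. Qed.

Lemma lin_addf (V : lmodType k) (f g : F -> V) (e : k) a :
  lin (fun x => e *: f x + g x) a = e *: lin f a + lin g a.
Proof.
rewrite /lin scaler_sumr -big_split; apply: eq_bigr => x _ /=.
by rewrite scalerDr !scalerA mulrC.
Qed.

Lemma gring_ind (P : R -> Prop) : P 0 ->
  (forall (e : k) x a, P a -> P (e *: gr x + a)) -> forall a, P a.
Proof.
by move=> P0 PD a; rewrite [a]grE; apply: big_rec => // x b _; apply: PD.
Qed.

Definition grmul : R -> R -> R := locked_with gring_key
  (fun a b => lin (fun x => lin (fun y => gr (x * y)%g) b) a).

Lemma grmulE a b : grmul a b = lin (fun x => lin (fun y => gr (x * y)%g) b) a.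
Proof. by rewrite /grmul locked_withE. Qed.

Local Notation "a *r b" := (grmul a b) (at level 40, left associativity).

Lemma grmul_linl (e : k) a a' b : (e *: a + a') *r b = e *: (a *r b) + a' *r b.
Proof. by rewrite !grmulE; apply: linearP. Qed.

Lemma grmul_linr a (e : k) b b' : a *r (e *: b + b') = e *: (a *r b) + a *r b'.
Proof.
rewrite !grmulE -lin_addf; apply: eq_lin => x; exact: lin_is_linear.
Qed.

Lemma grmul0l b : 0 *r b = 0. Proof. by rewrite grmulE; apply: linear0. Qed.

Lemma grmul0r a : a *r 0 = 0.
Proof. by have := grmul_linr a (-1) 0 0; rewrite scaler0 addr0 scaleN1r addNr. Qed.

Lemma grmul_gr x y : gr x *r gr y = gr (x * y)%g.
Proof. by rewrite grmulE !lin_gr. Qed.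

Lemma grmulA : associative grmul.
Proof.
have A1 x y d : gr x *r (gr y *r d) = (gr x *r gr y) *r d.
  elim/gring_ind: d => [|e z d IHd].
    by rewrite (grmul0r (gr y)) (grmul0r (gr x)) (grmul0r (gr x *r gr y)).
  rewrite (grmul_linr (gr y) e) (grmul_linr (gr x) e) (grmul_linr (gr x *r gr y) e).
  by rewrite IHd (grmul_gr y z) (grmul_gr x y) (grmul_gr x) (grmul_gr _ z) mulgA.
have A2 x b d : gr x *r (b *r d) = (gr x *r b) *r d.
  elim/gring_ind: b => [|e y b IHb].
    by rewrite (grmul0l d) (grmul0r (gr x)) (grmul0l d).
  rewrite (grmul_linl e (gr y) b d) (grmul_linr (gr x) e (gr y) b).
  by rewrite (grmul_linr (gr x) e) (grmul_linl e _ _ d) IHb A1.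
elim/gring_ind=> [|e x a IHa] b d.
  by rewrite (grmul0l (b *r d)) (grmul0l b) (grmul0l d).
by rewrite (grmul_linl e (gr x) a b) (grmul_linl e _ _ d) (grmul_linl e (gr x) a) IHa A2.
Qed.

Lemma grmul1l : left_id (gr 1%g) grmul.
Proof.
elim/gring_ind=> [|e x a IHa]; first by rewrite grmul0r.
by rewrite grmul_linr IHa grmul_gr mul1g.
Qed.

Lemma grmul1r : right_id (gr 1%g) grmul.
Proof.
elim/gring_ind=> [|e x a IHa]; first by rewrite grmul0l.
by rewrite grmul_linl IHa grmul_gr mulg1.
Qed.

Lemma grmulDl : left_distributive grmul +%R.
Proof. by move=> a b d; have := grmul_linl 1 a b d; rewrite !scale1r. Qed.

Lemma grmulDr : right_distributive grmul +%R.
Proof. by move=> a b d; have := grmul_linr a 1 b d; rewrite !scale1r. Qed.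

Lemma gr1_neq0 : gr 1%g != 0.
Proof.
apply/eqP => /(congr1 (cf 1%g)); rewrite cf_gr eqxx linear0.
by move/eqP; rewrite oner_eq0.
Qed.

HB.instance Definition _ := GRing.Zmodule_isNzRing.Build R
  grmulA grmul1l grmul1r grmulDl grmulDr gr1_neq0.

Lemma grmulZl e a b : e *: (a * b) = (e *: a) * b.
Proof. by have := grmul_linl e a 0 b; rewrite grmul0l !addr0. Qed.
HB.instance Definition _ := GRing.Lmodule_isLalgebra.Build k R grmulZl.

Lemma grmulZr e a b : e *: (a * b) = a * (e *: b).
Proof. by have := grmul_linr a e b 0; rewrite grmul0r !addr0. Qed.
HB.instance Definition _ := GRing.Lalgebra_isAlgebra.Build k R grmulZr.

Lemma gr1 : gr 1%g = 1. Proof. by []. Qed.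

Lemma grM x y : gr (x * y)%g = gr x * gr y.
Proof. by rewrite -grmul_gr. Qed.

Lemma grVK x : gr x^-1%g * gr x = 1.
Proof. by rewrite -grM mulVg. Qed.

Lemma grKV x : gr x * gr x^-1%g = 1.
Proof. by rewrite -grM mulgV. Qed.

Lemma gr_scaleM e e' x y : (e *: gr x) * (e' *: gr y) = (e * e') *: gr (x * y)%g.
Proof. by rewrite -scalerAl -scalerAr -grM scalerA. Qed.

Lemma cfZD x e a b : cf x (e *: a + b) = e * cf x a + cf x b.
Proof. exact: cf_is_scalar. Qed.

Lemma cf_grl x y a : cf y (gr x * a) = cf (x^-1 * y)%g a.
Proof.
elim/gring_ind: a => [|e z a IHa]; first by rewrite mulr0 !linear0.
rewrite mulrDr -scalerAr -grM !cfZD IHa !cf_gr.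
by rewrite -[in RHS](inj_eq (mulgI x)) mulVKg.
Qed.

Lemma cf_grr x y a : cf y (a * gr x) = cf (y * x^-1)%g a.
Proof.
elim/gring_ind: a => [|e z a IHa]; first by rewrite mul0r !linear0.
rewrite mulrDl -scalerAl -grM !cfZD IHa !cf_gr.
by rewrite -[in RHS](inj_eq (mulIg x)) mulgVK.
Qed.

Definition res (X : pred F) a : R := lin (fun x => if X x then gr x else 0) a.
HB.instance Definition _ X :=
  GRing.isLinear.Build k R R _ (res X) (@lin_is_linear k F R _).

Lemma res_gr X x : res X (gr x) = if X x then gr x else 0.
Proof. exact: lin_gr. Qed.

Lemma resZD X e a b : res X (e *: a + b) = e *: res X a + res X b.
Proof. exact: lin_is_linear. Qed.

Lemma cf_res X x a : cf x (res X a) = if X x then cf x a else 0.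
Proof.
elim/gring_ind: a => [|e y a IHa]; first by rewrite !linear0 if_same.
rewrite resZD !cfZD IHa res_gr cf_gr.
have [<-|nyx] := eqVneq y x; first by case: ifP; rewrite ?cf_gr ?eqxx ?linear0 ?mulr0 ?addr0.
by case: (X y); case: (X x); rewrite ?cf_gr ?(negbTE nyx) ?linear0 ?mulr0 ?add0r ?addr0.
Qed.

Lemma mem_supp x a : (x \in msupp a) = (cf x a != 0).
Proof. by rewrite /cf mcoeff_neq0. Qed.

(** The common tool for cutting a product by supports: it extracts leading terms, leading cosets of
    a centralizer, and a single coset. *)
Lemma res_mul (X Y Z : pred F) a b :
    (forall x y, cf x a != 0 -> cf y b != 0 -> Z (x * y)%g = X x && Y y) ->
  res Z (a * b) = res X a * res Y b.
Proof.
have res_sum W (s : seq F) (f : F -> R) :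
    res W (\sum_(x <- s) f x) = \sum_(x <- s) res W (f x).
  exact: (raddf_sum (res W)).
have resZ W e c : res W (e *: c) = e *: res W c by rewrite -[e *: c]addr0 resZD linear0 addr0.
have resE W c : res W c = \sum_(x <- msupp c) res W (cf x c *: gr x).
  by rewrite {1}[c]grE res_sum.
move=> H; rewrite [in RHS]resE [X in _ = _ * X]resE.
have -> : a * b = (\sum_(x <- msupp a) cf x a *: gr x) *
  (\sum_(y <- msupp b) cf y b *: gr y) by rewrite -!grE.
rewrite !mulr_suml res_sum big_seq [RHS]big_seq.
apply: eq_bigr => x; rewrite mem_supp => ax.
rewrite !mulr_sumr res_sum big_seq [RHS]big_seq.
apply: eq_bigr => y; rewrite mem_supp => by0.
rewrite gr_scaleM (resZ Z) (res_gr Z) H // (resZ X) (resZ Y) (res_gr X) (res_gr Y).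
by case: (X x); case: (Y y); rewrite ?gr_scaleM ?scaler0 ?mulr0 ?mul0r.
Qed.

Lemma res_id (X : pred F) a : (forall x, cf x a != 0 -> X x) -> res X a = a.
Proof.
move=> H; apply: cfP => x; rewrite cf_res; case: ifPn => // Xx.
by apply/esym/eqP; apply: contraNT Xx; apply: H.
Qed.

Definition aug a : k := lin (fun _ => 1 : k^o) a.
HB.instance Definition _ :=
  GRing.isLinear.Build k R k _ aug (@lin_is_linear k F k^o _).

Lemma aug_gr x : aug (gr x) = 1.
Proof. exact: (@lin_gr k^o (fun _ => 1)). Qed.

Lemma augZD e a b : aug (e *: a + b) = e * aug a + aug b.
Proof. exact: (@lin_is_linear k F k^o). Qed.

Lemma augM a b : aug (a * b) = aug a * aug b.
Proof.
elim/gring_ind: a => [|e x a IHa]; first by rewrite mul0r linear0 mul0r.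
rewrite mulrDl -scalerAl !augZD mulrDl IHa aug_gr mulr1.
congr (_ * _ + _); elim/gring_ind: b {IHa} => [|e' y b IHb].
  by rewrite mulr0.
by rewrite mulrDr -scalerAr -grM !augZD !aug_gr IHb.
Qed.

Lemma gring_neq0P a : a != 0 -> exists x, cf x a != 0.
Proof.
move=> a0; case E: (enum_fset (msupp a)) => [|x s].
  case/eqP: a0; apply: cfP => x; rewrite linear0; apply/eqP.
  rewrite -[_ == _]negbK -mem_supp; have -> : (x \in msupp a) = (x \in enum_fset (msupp a)) by [].
  by rewrite E.
exists x; rewrite -mem_supp; have -> : (x \in msupp a) = (x \in enum_fset (msupp a)) by [].
by rewrite E mem_head.
Qed.

End GroupRing.

(** * Group rings of ordered groups *)

Record biorder (F : groupType) (lt : F -> F -> Prop) : Prop := Biorder {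
  bi_irr : forall x, ~ lt x x;
  bi_trans : forall x y z, lt x y -> lt y z -> lt x z;
  bi_total : forall x y, x != y -> lt x y \/ lt y x;
  bi_mull : forall z x y, lt x y -> lt (z * x)%g (z * y)%g;
  bi_mulr : forall z x y, lt x y -> lt (x * z)%g (y * z)%g
}.

Lemma glt_biorder (T : finType) : biorder (@glt T).
Proof.
split; [exact: glt_irr | exact: glt_trans | exact: glt_total | |].
  exact: glt_mull.
exact: glt_mulr.
Qed.

(** Turns results on largest elements of a support into results on smallest ones. *)
Lemma biorder_rev (F : groupType) (lt : F -> F -> Prop) :
  biorder lt -> biorder (fun x y => lt y x).
Proof.
case=> irr tr tot ml mr; split=> //; first by move=> x y z Hxy Hyz; apply: tr Hyz Hxy.
- by move=> x y; rewrite eq_sym; apply: tot.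
- by move=> z x y; apply: ml.
- by move=> z x y; apply: mr.
Qed.

Section OrderedGroupRing.
Variables (k : fieldType) (F : groupType) (lt : F -> F -> Prop).
Hypothesis ord : biorder lt.
Local Notation R := (gring k F).
Implicit Types (a b : R) (x y z : F).

Lemma bi_asym x y : lt x y -> ~ lt y x.
Proof. by move=> lt_xy lt_yx; apply: (bi_irr ord (bi_trans ord lt_xy lt_yx)). Qed.

(** The key may identify elements: the identity gives leading terms, while a conjugate z |-> c ^ z
    gives the leading coset of the centralizer of c. *)
Lemma supp_max a (key : F -> F) : a != 0 -> exists2 x, cf x a != 0 &
  forall y, cf y a != 0 -> key y = key x \/ lt (key y) (key x).
Proof.
move=> /gring_neq0P[x0 ax0].
have key_max (s : seq F) : s != [::] -> exists2 x, x \in s &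
    forall y, y \in s -> key y = key x \/ lt (key y) (key x).
  elim: s => [|x s IH] // _; have [->|/IH[y sy maxy]] := eqVneq s [::].
    by exists x; rewrite ?mem_head // => y; rewrite inE => /eqP->; left.
  have [E|/(bi_total ord)[lt_xy|lt_yx]] := eqVneq (key x) (key y).
  - exists y => [|z]; rewrite inE ?sy ?orbT // => /orP[/eqP->|/maxy //].
    by left.
  - exists y => [|z]; rewrite inE ?sy ?orbT // => /orP[/eqP->|/maxy //].
    by right.
  exists x => [|z]; rewrite inE ?eqxx // => /orP[/eqP->|/maxy [->|lt_zy]].
  - by left.
  - by right.
  by right; apply: (bi_trans ord) lt_zy lt_yx.
have [|x sx maxx] := key_max (enum_fset (msupp a)).
  by move: ax0; rewrite -mem_supp -[_ \in _]/(x0 \in enum_fset _); case: enum_fset.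
by exists x => [|y ay]; [rewrite -mem_supp | apply: maxx; rewrite [_ \in _]mem_supp].
Qed.

Lemma res1 x a : res (pred1 x) a = cf x a *: gr k x.
Proof.
apply: cfP => y; rewrite cf_res /=; rewrite -[cf x a *: _]addr0 cfZD cf_gr linear0.
rewrite addr0 eq_sym; have [->|_] := eqVneq x y; first by rewrite mulr1.
by rewrite mulr0.
Qed.

(** The product of the two largest support elements arises from no other pair, by invariance of the
    order on both sides. *)
Lemma gring_mul_neq0 a b : a != 0 -> b != 0 -> a * b != 0.
Proof.
move=> /(supp_max id)[x ax maxx] /(supp_max id)[y by0 maxy].
have E : res (pred1 (x * y)%g) (a * b) = (cf x a *: gr k x) * (cf y b *: gr k y).
  rewrite -!res1; apply: res_mul => x' y' /maxx Hx /maxy Hy /=.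
  apply/eqP/andP => [Exy | [/eqP-> /eqP->] //].
  case: Hx Exy => /= [->|lt_x]; first by move/mulgI->; rewrite !eqxx.
  have lt_xy' := bi_mulr ord y' lt_x.
  case: Hy => /= [Ey|lt_y] Exy; exfalso.
    by rewrite Exy Ey in lt_xy'; apply: bi_irr lt_xy'.
  rewrite Exy in lt_xy'; apply: (bi_asym lt_xy').
  exact: bi_mull.
apply: contraTneq isT => ab0; move: E; rewrite ab0 linear0 gr_scaleM.
move/(congr1 (cf (x * y)%g)); rewrite -[_ *: gr _ _]addr0 cfZD cf_gr eqxx linear0.
by rewrite mulr1 addr0 => /esym/eqP; rewrite mulf_eq0 (negbTE ax) (negbTE by0).
Qed.

Lemma gring_mulf_eq0 a b : a * b = 0 -> a = 0 \/ b = 0.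
Proof.
move=> ab0; have [->|a0] := eqVneq a 0; first by left.
have [->|b0] := eqVneq b 0; first by right.
by have := gring_mul_neq0 a0 b0; rewrite ab0 eqxx.
Qed.

Lemma gring_mulfI a : a != 0 -> injective (fun b => a * b).
Proof.
move=> a0 b b' /eqP; rewrite -subr_eq0 -mulrBr => /eqP/gring_mulf_eq0[/eqP|/eqP].
  by rewrite (negbTE a0).
by rewrite subr_eq0 => /eqP.
Qed.

Lemma gr_inj : injective (gr k (F := F)).
Proof.
move=> x y /(congr1 (cf y)); rewrite !cf_gr eqxx.
by case: eqVneq => // _ /esym/eqP; rewrite oner_eq0.
Qed.

Lemma conj_lt x y z : lt x y -> lt (x ^ z)%g (y ^ z)%g.
Proof. by move=> lt_xy; apply: (bi_mull ord); apply: (bi_mulr ord). Qed.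

(** Let N be the largest key M ^ y over the support of b. The part of a b with key N is the product
    of the leading parts of a and b, so it is not zero. But a b = c - 1 is supported on c and 1,
    whose key is c; hence N = c. *)
Lemma factor_top a b (c : F) x : c != 1%g -> a * b = gr k c - 1 -> cf x a != 0 ->
    (forall y, cf y a != 0 -> (c ^ y)%g = (c ^ x)%g \/ lt (c ^ y)%g (c ^ x)%g) ->
  forall y, cf y b != 0 -> ((c ^ x) ^ y)%g = c \/ lt ((c ^ x) ^ y)%g c.
Proof.
move=> c1 Eab ax maxx; have ab0 : a * b != 0.
  by rewrite Eab subr_eq0 -gr1; apply: contraNneq c1 => /gr_inj->.
have b0 : b != 0 by apply: contraNneq ab0 => ->; rewrite mulr0.
set M := (c ^ x)%g in maxx *.
have [y by0] := supp_max (fun y => M ^ y)%g b0; set N := (M ^ y)%g => maxy.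
suff <- : N = c by [].
pose X := [pred z | (c ^ z)%g == M]; pose Y := [pred z | (M ^ z)%g == N].
pose Z := [pred z | (c ^ z)%g == N].
have E : res Z (a * b) = res X a * res Y b.
  apply: res_mul => x' y' /maxx Hx /maxy Hy; rewrite /= conjgM.
  case: Hx => [->|lt_x]; first by rewrite eqxx.
  have /negbTE-> : (c ^ x')%g != M.
    by apply: contra_not_neq (@bi_irr _ _ ord M) => Ex; rewrite Ex in lt_x.
  have {}lt_x := conj_lt y' lt_x; apply/negP => /eqP E; rewrite E in lt_x.
  by case: Hy => [Ey|/bi_asym[]//]; rewrite Ey in lt_x; apply: bi_irr lt_x.
have : res Z (a * b) != 0.
  rewrite E; apply: gring_mul_neq0.
    by apply: contraNneq ax => /(congr1 (cf x)); rewrite cf_res /= eqxx linear0 => ->.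
  by apply: contraNneq by0 => /(congr1 (cf y)); rewrite cf_res /= eqxx linear0 => ->.
case/gring_neq0P=> z; rewrite cf_res /=; case: ifP => [/eqP Ez|_]; last by rewrite eqxx.
rewrite Eab linearB /= -gr1 !cf_gr -Ez.
case: (eqVneq c z) => [<- _|_]; first by rewrite conjgE mulKg.
by case: (eqVneq 1%g z) => [<- _|_]; rewrite ?conjg1 // subrr eqxx.
Qed.

End OrderedGroupRing.

(* The conjugates c ^ x parametrize the right cosets of the centralizer of c, and
   their order is invariant under conjugation: the extreme cosets of a times those
   of b must both give c, the only key in the support of c - 1. *)
Lemma factor_centralizer (k : fieldType) (F : groupType) (lt : F -> F -> Prop)
    (a b : gring k F) (c : F) :
  biorder lt -> c != 1%g -> a * b = gr k c - 1 ->
  forall x y, cf x a != 0 -> cf y a != 0 -> (c ^ x = c ^ y)%g.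
Proof.
move=> ord c1 Eab.
have ab0 : a * b != 0.
  by rewrite Eab subr_eq0 -gr1; apply: contraNneq c1 => /gr_inj->.
have a0 : a != 0 by apply: contraNneq ab0 => ->; rewrite mul0r.
have b0 : b != 0 by apply: contraNneq ab0 => ->; rewrite mulr0.
have dro := biorder_rev ord.
have [x ax maxx] := supp_max ord (fun z => c ^ z)%g a0.
have [y ay miny] := supp_max dro (fun z => c ^ z)%g a0.
have [g bg] := gring_neq0P b0.
(* For g in the support of b, the largest key M and the smallest key m of a satisfy M ^ g <= c <= m
   ^ g. Conjugation preserves the order, so M = m. *)
have topx := factor_top ord c1 Eab ax maxx bg.
have topy := factor_top dro c1 Eab ay miny bg.
have E : (c ^ x = c ^ y)%g.
  case: (maxx y ay) => // /(conj_lt ord g) lt_yx; exfalso.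
  case: topx topy lt_yx => [->|ltx] [->|lty] lt_yx.
  - exact: bi_irr lt_yx.
  - exact: (bi_asym ord lty).
  - exact: (bi_asym ord ltx).
  - exact: (bi_asym ord (bi_trans ord lty lt_yx)).
suff key z : cf z a != 0 -> (c ^ z = c ^ x)%g by move=> z t /key-> /key->.
move=> az; case: (maxx z az) => // lt_z; case: (miny z az) => [->//|].
by rewrite -E => /(bi_asym ord).
Qed.

(** * Fox derivatives and relations *)

Lemma wval_mulw (F : groupType) (T : finType) (phi : T -> F) s s' :
  wval phi (mulw s s') = (wval phi s * wval phi s')%g.
Proof.
by elim: s => [|l s IH] /=; rewrite ?mul1g // wval_lact IH mulgA.
Qed.

Lemma wval_fgen (T : finType) (x : free_group T) : wval (@fgen T) (fgval x) = x.
Proof.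
apply: val_inj => /=; have := fgvalP x; elim: (fgval x) => [|l s IH] //= Hs.
transitivity (mulw (fgval (lval (@fgen T) l)) (fgval (wval (@fgen T) s))) => //.
rewrite IH; last exact: path_sorted Hs.
have -> : fgval (lval (@fgen T) l) = [:: l] by case: l {Hs} => t [].
exact: (@mulw_cat _ [:: l] s).
Qed.

Section Fox.
Variables (k : fieldType) (F : groupType) (T : finType) (phi : T -> F).
Local Notation R := (gring k F).

(** Fox derivatives with values pushed along phi into the group ring of F. They are computed on
    arbitrary words; [fox_lact] shows that cancellation does not change them. *)
Definition fox1 (t : T) (l : T * bool) : R :=
  if l.1 == t then (if l.2 then 1 else - gr k (phi t)^-1%g) else 0.

Definition fox (t : T) (s : seq (T * bool)) : R :=
  foldr (fun l d => fox1 t l + gr k (lval phi l) * d) 0 s.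

Lemma fox1_linv t l : gr k (lval phi l) * fox1 t (linv l) = - fox1 t l.
Proof.
rewrite /fox1 /=; case: eqP => [<-|_]; last by rewrite mulr0 oppr0.
by case: l => u [] /=; rewrite ?mulrN ?grKV // mulr1 opprK.
Qed.

Lemma fox_lact t l s : fox t (lact l s) = fox1 t l + gr k (lval phi l) * fox t s.
Proof.
case: s => [|l' s] //=; case: eqP => [->|] //=.
rewrite mulrDr fox1_linv addrA subrr add0r mulrA -grM lval_linv mulgV.
by rewrite mul1r.
Qed.

Lemma fox_cat t s s' : fox t (s ++ s') = fox t s + gr k (wval phi s) * fox t s'.
Proof.
elim: s => [|l s IH] /=; first by rewrite gr1 mul1r add0r.
by rewrite IH mulrDr addrA grM mulrA.
Qed.

Lemma fox_mulw t s s' : fox t (mulw s s') = fox t s + gr k (wval phi s) * fox t s'.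
Proof.
rewrite -fox_cat; elim: s => [|l s IH] //=.
by rewrite fox_lact IH.
Qed.

Lemma fox_fundamental s :
  \sum_t fox t s * (gr k (phi t) - 1) = gr k (wval phi s) - 1.
Proof.
elim: s => [|l s IH] /=.
  by rewrite gr1 subrr big1 // => t _; rewrite mul0r.
under eq_bigr => t _ do rewrite mulrDl -mulrA.
rewrite big_split /= -mulr_sumr IH mulrBr mulr1 -grM.
have -> : \sum_t fox1 t l * (gr k (phi t) - 1) = gr k (lval phi l) - 1.
  rewrite (bigD1 l.1) //= big1 => [|t /negbTE nt]; last first.
    by rewrite /fox1 eq_sym nt mul0r.
  rewrite addr0 /fox1 eqxx; case: l => t [] /=; first by rewrite mul1r.
  by rewrite mulNr mulrBr grVK mulr1 opprB.
by rewrite addrC addrA subrK.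
Qed.

End Fox.

Section FreeIndependence.
Variables (k : fieldType) (T : finType).
Local Notation F := (free_group T).
Local Notation R := (gring k F).

Definition fderiv (t : T) (a : R) : R :=
  lin (fun x : F => fox k (@fgen T) t (fgval x)) a.

Lemma fderivZD t e a b : fderiv t (e *: a + b) = e *: fderiv t a + fderiv t b.
Proof. exact: lin_is_linear. Qed.

Lemma fderiv0 t : fderiv t 0 = 0.
Proof. exact: (linear0 (lin _)). Qed.

Lemma fderivB t a b : fderiv t (a - b) = fderiv t a - fderiv t b.
Proof. exact: (linearB (lin _)). Qed.

Lemma fderiv_gr t (x : F) : fderiv t (gr k x) = fox k (@fgen T) t (fgval x).
Proof. exact: (@lin_gr k F). Qed.

Lemma fderiv_gen t u a : fderiv t (a * (gr k (fgen u) - 1)) = if t == u then a else 0.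
Proof.
elim/gring_ind: a => [|e x a IHa]; first by rewrite mul0r fderiv0 if_same.
rewrite mulrDl -scalerAl fderivZD IHa mulrBr mulr1 -grM fderivB !fderiv_gr.
have -> : fgval (x * fgen u)%g = mulw (fgval x) (fgval (fgen u)) by [].
rewrite fox_mulw wval_fgen /= mulr0 addr0 /fox1 /= eq_sym [fox _ _ _ _ + _]addrC addrK.
by case: eqP; rewrite ?mulr1 // mulr0 scaler0 add0r.
Qed.

(** The augmentation ideal of a free group is a free left module on the elements x_t - 1: Fox
    derivatives, extended linearly, are its coordinates. *)
Lemma free_independent (y : T -> R) :
  \sum_t y t * (gr k (fgen t) - 1) = 0 -> forall t, y t = 0.
Proof.
move=> E t; have : fderiv t (\sum_t y t * (gr k (fgen t) - 1)) = 0.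
  by rewrite E fderiv0.
rewrite /fderiv linear_sum (bigD1 t) //= -/(fderiv _ _) fderiv_gen eqxx.
rewrite big1 ?addr0 // => u /negbTE nu; rewrite -/(fderiv _ _) fderiv_gen.
by rewrite eq_sym nu.
Qed.

End FreeIndependence.

(** * Modules of relations under Nielsen moves *)

Section Relations.
Variables (k : fieldType) (F : groupType) (I : finType).
Local Notation R := (gring k F).
Implicit Types (g : I -> F) (y p : I -> R).

Definition rel_sum g y : R := \sum_i y i * (gr k (g i) - 1).

Definition cyclic_relations g := exists2 p, rel_sum g p = 0 &
  forall y, rel_sum g y = 0 -> exists rho : R, forall i, y i = rho * p i.

(** An elementary move changes the relations by the substitution y_i := y_i + y_j B, y_j := y_j A.
    It is left linear, and invertible because A is, so it carries a generator to a generator. *)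
Lemma cyclic_upd g i j h (A A' B : R) : i != j -> A * A' = 1 -> A' * A = 1 ->
    gr k h - 1 = A * (gr k (g j) - 1) + B * (gr k (g i) - 1) ->
  cyclic_relations (upd g j h) -> cyclic_relations g.
Proof.
move=> nij AA' A'A Eh [p Kp gen].
pose tr y := upd (upd y i (y i + y j * B)) j (y j * A).
have Etr y : rel_sum g (tr y) = rel_sum (upd g j h) y.
  rewrite /rel_sum (bigD1 j) //= (bigD1 i) //= [RHS](bigD1 j) //= [in RHS](bigD1 i) //=.
  rewrite /tr /upd !eqxx !(negbTE nij) Eh !addrA; congr (_ + _).
    by rewrite [y j * (_ + _)]mulrDr [(y i + _) * _]mulrDl !mulrA -addrA [y i * _ + _]addrC.
  by apply: eq_bigr => l /andP[/negbTE-> /negbTE->].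
exists (tr p) => [|y Ky]; first by rewrite Etr.
pose y' := upd (upd y i (y i - y j * A' * B)) j (y j * A').
have Ey l : tr y' l = y l.
  rewrite /tr /y' /upd eqxx (negbTE nij) eqxx.
  case: eqVneq => [->|nlj]; first by rewrite -mulrA A'A mulr1.
  by case: eqVneq => [->|//]; rewrite subrK.
have [|rho Erho] := gen y'.
  by rewrite -Etr -[RHS]Ky; apply: eq_bigr => l _; rewrite Ey.
exists rho => l; rewrite -Ey /tr /upd !Erho.
by do 2?case: eqP => _; rewrite // ?mulrDr !mulrA.
Qed.

End Relations.

Section Generating.
Variables (F : groupType) (I : finType).
Implicit Types (g : I -> F).

Definition generates g := forall x, exists s, wval g s = x.

Lemma generates_trans g g' : generates g ->
  (forall i, exists s, wval g' s = g i) -> generates g'.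
Proof.
move=> gen H x; have [s <-] := gen x; elim: s => [|[i e] s [s' Es']] /=.
  by exists [::].
have [u Eu] := H i; exists ((if e then u else invw u) ++ s').
by rewrite wval_cat Es' /lval; case: e => /=; rewrite ?wval_invw Eu.
Qed.

Lemma lval_upd g j x i e : i != j -> lval (upd g j x) (i, e) = sg e (g i).
Proof. by rewrite /lval /upd => /negbTE /= ->. Qed.

Lemma generates_updl g i j e : i != j -> generates g ->
  generates (upd g j (sg e (g i) * g j)%g).
Proof.
move=> nij /generates_trans; apply=> l; have [->|nlj] := eqVneq l j.
  exists [:: (i, ~~ e); (j, true)]; rewrite /= (lval_upd _ _ _ nij) sgN.
  by rewrite /lval /upd /= eqxx mulg1 mulKg.
by exists [:: (l, true)]; rewrite /= lval_upd //= mulg1.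
Qed.

Lemma generates_updr g i j e : i != j -> generates g ->
  generates (upd g j (g j * sg e (g i))%g).
Proof.
move=> nij /generates_trans; apply=> l; have [->|nlj] := eqVneq l j.
  exists [:: (j, true); (i, ~~ e)]; rewrite /= (lval_upd _ _ _ nij) sgN.
  by rewrite /lval /upd /= eqxx mulg1 mulgK.
by exists [:: (l, true)]; rewrite /= lval_upd //= mulg1.
Qed.
End Generating.

Section CyclicRelations.
Variables (k : fieldType) (T I : finType).
Local Notation F := (free_group T).
Local Notation R := (gring k F).
Implicit Types (g : I -> F).

Lemma gr_sg (x : F) e : exists2 u : R, gr k (sg e x) - 1 = u * (gr k x - 1) &
  exists u', u * u' = 1.
Proof.
case: e => /=; first by exists 1; rewrite ?mul1r //; exists 1; rewrite mul1r.
exists (- gr k x^-1%g); first by rewrite mulNr mulrBr grVK mulr1 opprB.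
by exists (- gr k x); rewrite mulrNN grVK.
Qed.

Lemma irr_letter g t : irreducible_tuple g -> generates g ->
  exists a, lval g a = fgen t.
Proof. by move=> irr gen; have [s Es] := gen (fgen t); exact: (irr_gen irr Es (erefl _)). Qed.

(** Basis letters have length 1, so by [irr_gen] each of them is an entry up to inversion. By
    counting, one index j0 is left over, and its entry is trivial: an entry that is a letter could
    cancel the first letter of it. As the other entries are independent, the unit vector at j0
    generates the relations. *)
Lemma irr_cyclic g : #|I| = #|T|.+1 -> irreducible_tuple g -> generates g ->
  cyclic_relations k g.
Proof.
move=> cardI irr gen.
have /fin_all_exists[a Ea] : forall t, exists a, lval g a = fgen t.
  by move=> t; apply: irr_letter.
pose sigma t := (a t).1.
have Egs t : g (sigma t) = sg (a t).2 (fgen t).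
  by rewrite -Ea /lval /sigma; case: (a t) => i [] /=; rewrite ?invgK.
have sigma_inj : injective sigma.
  move=> t t' E; have := Egs t; rewrite E Egs => /(congr1 (@fgval T)).
  by case: (a t).2; case: (a t').2 => [] [].
have [j0 nj0] : exists j0, j0 \notin codom sigma.
  apply/existsP; rewrite -negb_forall; apply/negP => /forallP H.
  have : (#|I| <= #|T|)%N by rewrite -(card_codom sigma_inj); apply/subset_leq_card/subsetP.
  by rewrite cardI ltnn.
have codomE i : (i \in codom sigma) = (i != j0).
  have [->|nij] := eqVneq i j0; first exact/negbTE.
  apply: contraT => ni.
  have : (#|[predU1 i & [predU1 j0 & codom sigma]]| <= #|I|)%N by apply: max_card.
  by rewrite !cardU1 !inE negb_or nij ni nj0 card_codom // cardI !add1n ltnn.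
have gj0 : g j0 = 1%g.
  case E: (fgval (g j0)) => [|l s]; first exact: val_inj.
  have [b [Eb1 Eb2]] : exists b : I * bool, b.1 != j0 /\ fgval (lval g b) = [:: linv l].
    have na : (a l.1).1 != j0 by rewrite -codomE; apply: (codom_f sigma).
    have [l2|l2] := boolP l.2.
      exists (linv (a l.1)); split=> //; rewrite lval_linv Ea.
      by rewrite /linv l2.
    exists (a l.1); split=> //; rewrite Ea.
    by rewrite /linv (negbTE l2).
  have := @wt_irr _ _ g irr b (j0, true) Eb1.
  move/fglen_wt; rewrite /fglen.
  have -> : fgval (lval g b * lval g (j0, true))%g = s.
    transitivity (mulw (fgval (lval g b)) (fgval (g j0))) => //.
    by rewrite Eb2 E /= linvK eqxx.
  by rewrite /lval /= E /= ltnn.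
have sumE (y : I -> R) : rel_sum g y = \sum_t y (sigma t) * (gr k (g (sigma t)) - 1).
  rewrite /rel_sum (bigD1 j0) //= gj0 gr1 subrr mulr0 add0r.
  pose f i := y i * (gr k (g i) - 1).
  transitivity (\sum_(i in sigma @: [set: T]) f i).
    apply: eq_bigl => i; rewrite -codomE.
    by apply/codomP/imsetP => -[t]; exists t.
  rewrite big_imset /=; last by move=> t t' _ _; apply: sigma_inj.
  by apply: eq_bigl => t; rewrite inE.
exists (fun i => (i == j0)%:R) => [|y].
  by rewrite sumE big1 // => t _; rewrite -[_ == _]negbK -codomE codom_f mul0r.
rewrite sumE => Ky; exists (y j0) => i.
have [->|] := eqVneq i j0; first by rewrite mulr1.
rewrite -codomE mulr0 => /codomP[t ->].
have [u Hu] := fin_all_exists2 (fun t => gr_sg (fgen t) (a t).2).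
move=> Hu'; have [u' uu'] := Hu' t.
have := @free_independent k T (fun t => y (sigma t) * u t) _ t.
rewrite -[RHS]Ky => /(_ _)/(congr1 (fun z => z * u')); rewrite -mulrA uu' mulr1 mul0r.
by apply; apply: eq_bigr => t' _; rewrite Egs Hu mulrA.
Qed.

Theorem cyclic_relations_gen g : #|I| = #|T|.+1 -> generates g -> cyclic_relations k g.
Proof.
move=> cardI; move: g; apply: nielsen_ind => [g i j e nij IH|g i j e nij IH|g irr] gen.
- have [u Eu [u' uu']] := gr_sg (g i) e.
  (* With x = g_i^e, the move is read off from x g_j - 1 = x (g_j - 1) + (x - 1). *)
  apply: (@cyclic_upd _ _ _ g i j (sg e (g i) * g j)%g (gr k (sg e (g i))) (gr k (sg e (g i))^-1%g) u nij).
  + exact: grKV.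
  + exact: grVK.
  + by rewrite mulrBr mulr1 -Eu grM addrA subrK.
  exact/IH/generates_updl.
- have [u Eu [u' uu']] := gr_sg (g i) e.
  (* With x = g_i^e, this time g_j x - 1 = (g_j - 1) + g_j (x - 1), so A = 1. *)
  apply: (@cyclic_upd _ _ _ g i j (g j * sg e (g i))%g 1 1 (gr k (g j) * u) nij); rewrite ?mul1r //.
  + by rewrite -mulrA -Eu mulrBr mulr1 -grM [RHS]addrC addrA subrK.
  exact/IH/generates_updr.
exact: irr_cyclic.
Qed.

End CyclicRelations.

(** * Injectivity from the absence of relations *)

Section RelationFree.
Variables (k : fieldType) (F : groupType) (T : finType) (phi : T -> F).
Local Notation R := (gring k F).
Implicit Types s : seq (T * bool).

(** Each term of a Fox derivative is, up to sign, the value of a prefix, that is, a vertex on the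
    path that the word traces in F. *)
Lemma cf_fox0 t s x : (forall i, (i <= size s)%N -> wval phi (take i s) != x) ->
  cf x (fox k phi t s) = 0.
Proof.
elim: s x => [|l s IH] x H; first by rewrite /= linear0.
rewrite /= linearD /= cf_grl IH ?addr0 => [|i lti]; last first.
  rewrite -(inj_eq (mulgI (lval phi l))) mulVKg.
  exact: (H i.+1).
rewrite /fox1; case: eqP => [Et|_]; last by rewrite linear0.
have x1 := H 0 isT; have xl := H 1%N isT.
case: l Et x1 xl {H} => [u []] /= -> x1 xl.
  by rewrite -gr1 cf_gr (negbTE x1).
rewrite linearN /= cf_gr; move: xl; rewrite take0 /= mulg1 /lval /= => /negbTE->.
by rewrite oppr0.
Qed.

Lemma supp_fox t s x : cf x (fox k phi t s) != 0 -> exists s', wval phi s' = x.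
Proof.
have [/hasP[i _ /eqP Ei] _|/hasPn H] :=
    boolP (has (fun i => wval phi (take i s) == x) (iota 0 (size s).+1)).
  by exists (take i s).
by rewrite cf_fox0 ?eqxx // => i lti; apply: H; rewrite mem_iota.
Qed.

Hypothesis indep : forall y : T -> R,
  \sum_t y t * (gr k (phi t) - 1) = 0 -> forall t, y t = 0.

(** A proper prefix in the kernel splits the word into shorter ones. Otherwise the path is simple:
    the first letter gives coefficient 1 at the identity in the t-derivative, and only the last
    letter could cancel it. By independence and the fundamental formula this derivative is 0. *)
Lemma indep_inj_pos n t s :
    (forall s', (size s' < n)%N -> wval phi s' = 1%g -> wval (@fgen T) s' = 1%g) ->
    size ((t, true) :: s) = n -> wval phi ((t, true) :: s) = 1%g ->
  wval (@fgen T) ((t, true) :: s) = 1%g.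
Proof.
set w := (t, true) :: s => IH Hn Hw.
have [/hasP[i] | /hasPn H] :=
    boolP (has (fun i => wval phi (take i.+1 w) == 1%g) (iota 0 (size s))).
  rewrite mem_iota add0n => /andP[_ lti] /eqP E.
  have Hd : wval phi (drop i.+1 w) = 1%g.
    by rewrite -[LHS]mul1g -{1}E -wval_cat cat_take_drop.
  rewrite -[w](cat_take_drop i.+1) wval_cat !IH ?mulg1 //.
    by rewrite size_drop -Hn /w [size _]/=; lia.
  by rewrite -Hn size_takel /w /= ltnS // ltnW.
have {}H i : (i < size s)%N -> wval phi (take i s) != (phi t)^-1%g.
  move=> lti; have := H i; rewrite mem_iota => /(_ lti); rewrite /w /=.
  by rewrite mulg_eq1 [X in ~~ X -> _]eq_sym -eqg_inv invgK.
have fox0 u : fox k phi u w = 0.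
  move: u; apply: indep; rewrite fox_fundamental Hw gr1; exact: subrr.
have := congr1 (cf 1%g) (fox0 t); subst w.
rewrite /= linearD linear0 /= cf_grl mulg1 /fox1 /= eqxx -gr1 cf_gr eqxx.
case: (lastP s) H Hn Hw {fox0} => [|s'' l] H Hn Hw.
  by rewrite linear0 addr0 => /eqP; rewrite oner_eq0.
have {}H i : (i <= size s'')%N -> wval phi (take i s'') != (phi t)^-1%g.
  move=> lti; have := H i; rewrite size_rcons ltnS => /(_ lti).
  by rewrite -cats1 takel_cat.
rewrite -cats1 fox_cat linearD /= cf_grl cf_fox0 // add0r mulr0 addr0 /fox1.
case: eqP => [Et|_]; last by rewrite linear0 addr0 => /eqP; rewrite oner_eq0.
case: l Et Hn Hw => [u []] /= -> Hn Hw.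
  rewrite -gr1 cf_gr eq_sym mulg_eq1 eqg_inv.
  have := H (size s'') (leqnn _); rewrite take_size => /negbTE H0.
  rewrite H0 addr0 => /eqP; rewrite oner_eq0 //.
(* What remains is w = t s'' t^-1, a conjugate of a shorter kernel word. *)
move=> _; have Hs : wval phi s'' = 1%g.
  move: Hw; rewrite /= -cats1 wval_cat /= mulg1 /lval /= => /(congr1 (fun z => z ^ phi t)%g).
  by rewrite conj1g conjgE mulgA mulKg mulgVK.
rewrite /= wval_cat /= IH ?mulg1 ?mul1g ?mulgV //.
by rewrite -Hn /= size_rcons; lia.
Qed.

(* A shortest kernel word traces a simple cycle in the Cayley graph, so one of its
   Fox derivatives has a nonzero coefficient. *)
Lemma indep_inj s : wval phi s = 1%g -> wval (@fgen T) s = 1%g.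
Proof.
have [n] := ubnP (size s); elim/ltn_ind: n s => n IHn s le_s Hs.
have IH s' : (size s' < size s)%N -> wval phi s' = 1%g -> wval (@fgen T) s' = 1%g.
  by move=> lt_s'; apply: (IHn (size s)).
(* Cyclic rotation conjugates the value, so any positive letter may be put in front; a word that
   begins with an inverse letter is inverted to provide one. *)
have rotated s0 s1 t s2 : size s0 = size s -> s0 = s1 ++ (t, true) :: s2 ->
    wval phi s0 = 1%g -> wval (@fgen T) s0 = 1%g.
  move=> Esz Es Hs0; have E (G : groupType) (psi : T -> G) : wval psi s0 = 1%g <->
      wval psi (((t, true) :: s2) ++ s1) = 1%g.
    rewrite Es !wval_cat; split=> /(canRL (mulgK _)).
      by rewrite mul1g => ->; rewrite mulgV.
    by rewrite mul1g => ->; rewrite mulgV.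
  apply/E; apply: (indep_inj_pos IH); last exact/(E F).
  by rewrite -Esz Es /= !size_cat /= addnS addnC.
case: s le_s Hs IH rotated => [|[t []] s] // le_s Hs IH rotated.
  exact: (rotated _ [::] t s).
rewrite -[LHS]invgK -wval_invw (rotated _ (invw s) t [::]) ?invg1 //.
- by rewrite size_invw.
- by rewrite invw_cons -cats1.
by rewrite wval_invw Hs invg1.
Qed.

End RelationFree.

(** * Divisors of c - 1 *)

Definition fhom (F : groupType) (T : finType) (phi : T -> F) (x : free_group T) : F :=
  wval phi (fgval x).

Section FreeHom.
Variables (F : groupType) (T : finType) (phi : T -> F).

Lemma fhomM x y : fhom phi (x * y)%g = (fhom phi x * fhom phi y)%g.
Proof. exact: wval_mulw. Qed.

Lemma fhom1 : fhom phi 1%g = 1%g. Proof. by []. Qed.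

Lemma fhomV x : fhom phi x^-1%g = (fhom phi x)^-1%g.
Proof. exact: wval_invw. Qed.

Lemma fhomX x n : fhom phi (x ^+ n)%g = (fhom phi x ^+ n)%g.
Proof. by elim: n => // n IH; rewrite !expgS fhomM IH. Qed.

Lemma fhom_fgen t : fhom phi (fgen t) = phi t.
Proof. by rewrite /fhom /= mulg1. Qed.

Lemma fhom_wval s : fhom phi (wval (@fgen T) s) = wval phi s.
Proof.
elim: s => [|[t b] s IH] //=; rewrite fhomM IH; congr (_ * _)%g.
by case: b; rewrite /lval /= ?fhomV fhom_fgen.
Qed.
End FreeHom.

Section GroupRingExtra.
Variables (k : fieldType) (F : groupType).
Local Notation R := (gring k F).

Lemma incyc_left (c x : F) : incyc c x -> exists z : R, gr k x - 1 = (gr k c - 1) * z.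
Proof.
have pow n : exists z : R, gr k (c ^+ n)%g - 1 = (gr k c - 1) * z.
  elim: n => [|n [z IH]]; first by exists 0; rewrite expg0 gr1 subrr mulr0.
  exists (gr k (c ^+ n)%g + z); rewrite mulrDr -IH expgS mulrBl mul1r -grM.
  by rewrite addrA subrK.
move=> [m [n ->]]; have [z Ez] := pow m; have [z' Ez'] := pow n.
exists ((z - z') * gr k (c ^- n)%g).
rewrite mulrA mulrBr -Ez -Ez' opprB addrA subrK.
by rewrite mulrBl -!grM mulgV.
Qed.

Lemma incyc_right (c x : F) : incyc c x -> exists z : R, gr k x - 1 = z * (gr k c - 1).
Proof.
have pow n : exists z : R, gr k (c ^+ n)%g - 1 = z * (gr k c - 1).
  elim: n => [|n [z IH]]; first by exists 0; rewrite expg0 gr1 subrr mul0r.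
  exists (gr k (c ^+ n)%g + z); rewrite mulrDl -IH expgSr mulrBr mulr1 -grM.
  by rewrite addrA subrK.
move=> [m [n ->]]; have [z Ez] := pow m; have [z' Ez'] := pow n.
have -> : (c ^+ m * c ^- n = c ^- n * c ^+ m)%g.
  by apply/esym; apply: commute_expV.
exists (gr k (c ^- n)%g * (z - z')).
rewrite -mulrA mulrBl -Ez -Ez' opprB addrA subrK.
by rewrite mulrBr -!grM mulVg.
Qed.

Lemma augE (a : R) : aug a = \sum_(x <- msupp a) cf x a.
Proof.
rewrite {1}[a]grE (raddf_sum (@aug k F)); apply: eq_bigr => x _.
by rewrite /= -[_ *: _]addr0 augZD aug_gr linear0 addr0 mulr1.
Qed.

Lemma sub_aug (c x0 : F) (a : R) :
    (forall x, cf x a != 0 -> exists z, gr k x - gr k x0 = (gr k c - 1) * z) ->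
  exists z, a - aug a *: gr k x0 = (gr k c - 1) * z.
Proof.
move=> H; rewrite augE {1}[a]grE scaler_suml -sumrB big_seq.
apply: (big_ind (fun v : R => exists z, v = (gr k c - 1) * z)) => [|u v [z ->] [z' ->]|x].
- by exists 0; rewrite mulr0.
- by exists (z + z'); rewrite mulrDr.
rewrite mem_supp => /H[z Ez]; exists (cf x a *: z).
by rewrite -scalerBr Ez scalerAr.
Qed.

Lemma supp_card (a b : R) x0 : cf x0 a != 0 -> cf x0 b = 0 ->
  (forall x, cf x b != 0 -> cf x a != 0) -> (#|` msupp b| < #|` msupp a|)%N.
Proof.
move=> a0 b0 H; apply: fproper_ltn_card; rewrite fproperEneq; apply/andP; split.
  by apply: contraNneq a0 => E; rewrite -[_ == _]negbK -mem_supp -E mem_supp b0 eqxx.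
by apply/fsubsetP => x; rewrite !mem_supp; apply: H.
Qed.
End GroupRingExtra.

Section Divisor.
Variables (k : fieldType) (F : groupType) (lt : F -> F -> Prop) (ord : biorder lt).
Variables (T : finType) (phi : T -> F) (t : free_group T).
Local Notation R := (gring k F).
Local Notation f := (fhom phi).
Local Notation c := (f t).
Hypothesis f_inj : forall x, f x = 1%g -> x = 1%g.
Hypothesis t_ind : forall z, commute t z -> incyc t z.
Hypothesis t1 : t != 1%g.

Lemma fhom_inj x y : f x = f y -> x = y.
Proof.
move=> E; apply/eqP; rewrite -divg_eq1; apply/eqP/f_inj.
by rewrite fhomM fhomV E mulgV.
Qed.

Lemma c_neq1 : c != 1%g.
Proof. by apply: contraNneq t1 => /f_inj->. Qed.

Lemma fhom_incyc x : incyc t x -> incyc c (f x).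
Proof. by move=> [m [n ->]]; exists m, n; rewrite fhomM fhomV !fhomX. Qed.

(* Cut the Fox derivatives of t along the cosets of the centralizer of c: on the
   image of phi these are cosets <c> x0, where y is congruent to aug y * x0 modulo
   c - 1 = a * b; if some such augmentation is nonzero, a is right invertible. *)
Lemma divisor_unit (a b : R) (p : T -> R) :
    (forall x, cf x a != 0 -> (c ^ x = c)%g) ->
    a * b = gr k c - 1 -> (forall u, fox k phi u (fgval t) = a * p u) ->
  exists d, a * d = 1.
Proof.
move=> supp_a Eab Ep.
suff step y q : y = a * q -> (forall x, cf x y != 0 -> exists x', f x' = x) ->
    (exists d, a * d = 1) \/ exists z, y = (gr k c - 1) * z.
  have [[u ndiv]|alldiv] := boolp.pselect (exists u,
      ~ exists z, fox k phi u (fgval t) = (gr k c - 1) * z).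
    case: (step _ _ (Ep u)) => // x /supp_fox[s <-].
    by exists (wval (@fgen T) s); rewrite fhom_wval.
  have /fin_all_exists[z Ez] :
      forall u, exists z, fox k phi u (fgval t) = (gr k c - 1) * z.
    by move=> u; apply: boolp.contrapT => nz; apply: alldiv; exists u.
  (* If c - 1 divided every Fox derivative on the left, cancelling it in the fundamental formula
     would write 1 as a sum of terms z_u (phi u - 1), whose augmentation is 0. *)
  exfalso; have := fox_fundamental k phi (fgval t).
  under eq_bigr => u _ do rewrite Ez -mulrA.
  rewrite -mulr_sumr -/c -[RHS]mulr1 => /(gring_mulfI ord) H.
  have /H/(congr1 (@aug k F)) : gr k c - 1 != 0.
    by rewrite subr_eq0 -gr1; apply: contraNneq c_neq1 => /gr_inj->.
  rewrite -gr1 aug_gr (raddf_sum (@aug k F)) /= big1 => [|u _].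
    by move/eqP; rewrite eq_sym oner_eq0.
  by rewrite augM (raddfB (@aug k F)) /= !aug_gr subrr mulr0.
have [n] := ubnP #|` msupp y|; elim: n y q => // n IH y q; rewrite ltnS => le_n Ey suppA.
have [-> | /gring_neq0P[x0 y0]] := eqVneq y 0.
  by right; exists 0; rewrite mulr0.
pose X := [pred x | c ^ x == c ^ x0]%g.
have EX : res X y = a * res X q.
  rewrite -[in RHS](@res_id k F predT a) // Ey; apply: res_mul => x z /supp_a Ex _ /=.
  by rewrite conjgM Ex.
have [z Ez] : exists z, res X y - aug (res X y) *: gr k x0 = (gr k c - 1) * z.
  apply: sub_aug => x; rewrite cf_res; case: ifP => [/eqP Xx yx|_]; last by rewrite eqxx.
  have [x' Ex'] := suppA _ yx; have [x0' Ex0'] := suppA _ y0.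
  (* Both x and x0 lie in the image of phi and in one right coset of the centralizer of c, so their
     quotient lifts to an element commuting with t, hence to a power of t. *)
  have /t_ind/fhom_incyc/(incyc_left k)[z] : commute t (x' * x0'^-1)%g.
    apply: fhom_inj; rewrite !fhomM fhomV Ex' Ex0'.
    move: Xx; rewrite !conjgE => /(congr1 (fun w => x * w * x0^-1)%g).
    by rewrite mulVKg !mulgA mulgK => ->.
  rewrite fhomM fhomV Ex' Ex0' => Ez; exists (z * gr k x0).
  by rewrite mulrA -Ez mulrBl mul1r -grM mulgVK.
have [aug0 | aug0] := eqVneq (aug (res X y)) 0; last first.
  (* The product [a * (res X q - b * z)] equals the nonzero augmentation times x0, which is
     invertible. *)
  left; exists ((res X q - b * z) * ((aug (res X y))^-1 *: gr k x0^-1%g)).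
  rewrite mulrA mulrBr -EX mulrA Eab -Ez opprB addrC subrK.
  by rewrite gr_scaleM divff // mulgV scale1r gr1.
rewrite aug0 scale0r subr0 in Ez.
have cfy x : cf x (y - res X y) = if X x then 0 else cf x y.
  by rewrite linearB /= cf_res /=; case: eqP; rewrite ?subrr ?subr0.
case: (IH (y - res X y) (q - res X q)).
- apply: leq_trans le_n; apply: (@supp_card _ _ _ _ x0) => //.
    by rewrite cfy /= eqxx.
  by move=> x; rewrite cfy; case: ifP => //; rewrite eqxx.
- by rewrite mulrBr -EX -Ey.
- by move=> x; rewrite cfy; case: ifP => [_|_ /suppA //]; rewrite eqxx.
- by left.
by move=> [z' Ez']; right; exists (z + z'); rewrite mulrDr -Ez -Ez' addrC subrK.
Qed.

End Divisor.

(** * Relations between two free factors *)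

Section TwoFactors.
Variables (k : fieldType) (F : groupType) (lt : F -> F -> Prop) (ord : biorder lt).
Local Notation R := (gring k F).

Definition joint_cyclic (T1 T2 : finType) (phi1 : T1 -> F) (phi2 : T2 -> F)
    (p : T1 -> R) (q : T2 -> R) :=
  forall y z, rel_sum phi1 y + rel_sum phi2 z = 0 -> exists rho : R,
    (forall t, y t = rho * p t) /\ (forall t, z t = rho * q t).

Lemma joint_cyclic_sym (T1 T2 : finType) (phi1 : T1 -> F) (phi2 : T2 -> F) p q :
  joint_cyclic phi1 phi2 p q -> joint_cyclic phi2 phi1 q p.
Proof. by move=> H y z; rewrite addrC => /H[rho []]; exists rho. Qed.

Lemma rel_sum0 (T : finType) (phi : T -> F) : rel_sum phi (fun _ => 0 : R) = 0.
Proof. by apply: big1 => t _; rewrite mul0r. Qed.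

Lemma rel_sumN (T : finType) (phi : T -> F) (y : T -> R) :
  rel_sum phi (fun t => - y t) = - rel_sum phi y.
Proof. by rewrite /rel_sum -sumrN; apply: eq_bigr => t _; rewrite mulNr. Qed.

Lemma rel_sumZ (T : finType) (phi : T -> F) (a : R) (y : T -> R) :
  rel_sum phi (fun t => a * y t) = a * rel_sum phi y.
Proof. by rewrite /rel_sum mulr_sumr; apply: eq_bigr => t _; rewrite mulrA. Qed.

Lemma rel_sum_fox (T : finType) (phi : T -> F) x :
  rel_sum phi (fun u => fox k phi u (fgval x)) = gr k (fhom phi x) - 1.
Proof. exact: fox_fundamental. Qed.

(** A nonzero relation y over phi1 alone is (y, 0) = rho (p, q) with rho nonzero, so q = 0. Then
    every relation has zero component over phi2. This makes phi2 injective, yet it also kills the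
    Fox derivatives of t2, so that t2 has image 1: a contradiction. *)
Lemma joint_independent (T1 T2 : finType) (phi1 : T1 -> F) (phi2 : T2 -> F) p q t1 t2 :
  joint_cyclic phi1 phi2 p q -> fhom phi1 t1 = fhom phi2 t2 -> t2 != 1%g ->
  forall y : T1 -> R, rel_sum phi1 y = 0 -> forall t, y t = 0.
Proof.
move=> cyc Et t2n1 y Ky t; apply: contraNeq t2n1 => yt.
have [rho [Ey E0]] : exists rho : R,
    (forall t, y t = rho * p t) /\ (forall t, 0 = rho * q t).
  by apply: cyc; rewrite Ky rel_sum0 addr0.
have q0 u : q u = 0.
  have := E0 u; case/esym/(gring_mulf_eq0 ord) => // rho0.
  by rewrite Ey rho0 mul0r eqxx in yt.
have indep2 (z : T2 -> R) : rel_sum phi2 z = 0 -> forall u, z u = 0.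
  move=> Kz u; have [|rho' [_ ->]] := cyc (fun=> 0) z; last by rewrite q0 mulr0.
  by rewrite rel_sum0 Kz addr0.
have [|rho' [_ E]] := cyc (fun u => fox k phi1 u (fgval t1))
    (fun u => - fox k phi2 u (fgval t2)).
  by rewrite rel_sumN !rel_sum_fox Et subrr.
have : gr k (fhom phi2 t2) = 1.
  apply/eqP; rewrite -subr_eq0 -rel_sum_fox; apply/eqP/big1 => u _.
  by rewrite -[fox _ _ _ _]opprK E q0 mulr0 oppr0 mul0r.
rewrite -gr1 => /gr_inj/(indep_inj indep2); rewrite wval_fgen => ->.
exact: eqxx.
Qed.

(** The Fox derivatives of t1 are a p with a invertible, so p may be replaced by them in any
    relation; summing over phi1 then leaves a multiple of c - 1. *)
Lemma joint_relation (T1 T2 : finType) (phi1 : T1 -> F) (phi2 : T2 -> F) p q t1 t2 :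
    joint_cyclic phi1 phi2 p q -> fhom phi1 t1 = fhom phi2 t2 ->
    t1 != 1%g -> t2 != 1%g -> (forall z, commute t1 z -> incyc t1 z) ->
  forall y z, rel_sum phi1 y + rel_sum phi2 z = 0 ->
  exists s : R, rel_sum phi1 y = s * (gr k (fhom phi1 t1) - 1).
Proof.
move=> cyc Et t1n1 t2n1 t_ind.
have indep1 := joint_independent cyc Et t2n1.
have inj1 x : fhom phi1 x = 1%g -> x = 1%g.
  by move/(indep_inj indep1); rewrite wval_fgen.
have c1 := c_neq1 inj1 t1n1; set c := fhom phi1 t1 in c1 *.
have [|a [Ea _]] := cyc (fun u => fox k phi1 u (fgval t1))
    (fun u => - fox k phi2 u (fgval t2)).
  by rewrite rel_sumN !rel_sum_fox Et subrr.
have Eab : a * rel_sum phi1 p = gr k c - 1.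
  by rewrite -rel_sum_fox -rel_sumZ; apply: eq_bigr => u _; rewrite Ea.
have a0 : a != 0.
  apply: contraNneq c1 => a0; move: Eab; rewrite a0 mul0r => /esym/eqP.
  by rewrite subr_eq0 -gr1 => /eqP/gr_inj->.
have [h ah] := gring_neq0P a0.
(* The support of a lies in one right coset of the centralizer, that of h; translation by h^-1 moves
   it into the centralizer itself. *)
have [|||d Ed] := @divisor_unit k F lt ord T1 phi1 t1 inj1 t_ind t1n1
    (a * gr k h^-1%g) (gr k h * rel_sum phi1 p) (fun u => gr k h * p u).
- move=> x; rewrite cf_grr invgK => axh.
  have := factor_centralizer ord c1 Eab axh ah.
  by rewrite conjgM => /conjg_inj.
- by rewrite mulrA -(mulrA a) grVK mulr1.
- by move=> u; rewrite mulrA -(mulrA a) grVK mulr1.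
set d' := gr k h^-1%g * d; have ad' : a * d' = 1 by rewrite /d' mulrA.
have d'a : d' * a = 1.
  by apply: (gring_mulfI ord a0); rewrite /= mulrA ad' mul1r mulr1.
move=> y z /cyc[rho [Ey _]]; exists (rho * d').
rewrite -rel_sum_fox -rel_sumZ; apply: eq_bigr => u _.
by rewrite Ey Ea mulrA -(mulrA rho d' a) d'a mulr1.
Qed.

End TwoFactors.

(** * Words in the amalgam *)

Section CosetIndicator.
Variables (k : fieldType) (F : groupType) (c : F).
Local Notation R := (gring k F).

(** Its linear extension sums the coefficients over <c>. As <c> is stable under right multiplication
    by c and its inverse, that functional vanishes on R (c - 1). *)
Definition coset_ind (x : F) : k^o := (boolp.asbool (incyc c x))%:R.
Definition coset_fun (a : R) : k := lin coset_ind a.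

Lemma coset_funZD e a b : coset_fun (e *: a + b) = e * coset_fun a + coset_fun b.
Proof. exact: (@lin_is_linear k F k^o). Qed.

Lemma coset_funD a b : coset_fun (a + b) = coset_fun a + coset_fun b.
Proof. by rewrite -[a]scale1r coset_funZD mul1r scale1r. Qed.

Lemma coset_fun0 : coset_fun 0 = 0.
Proof. by rewrite -[0](addNr 0) -scaleN1r coset_funZD mulN1r addNr. Qed.

Lemma coset_fun_gr x : coset_fun (gr k x) = coset_ind x.
Proof. exact: (@lin_gr k F k^o). Qed.

Lemma coset_fun_edge P x :
  coset_fun (gr k P * (gr k x - 1)) = coset_ind (P * x)%g - coset_ind P.
Proof.
rewrite mulrBr mulr1 -grM -!coset_fun_gr addrC -[- gr k P]scaleN1r coset_funZD.
by rewrite mulN1r addrC.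
Qed.

Lemma coset_ind_out x : ~ incyc c x -> coset_ind x = 0.
Proof. by move=> nx; rewrite /coset_ind boolp.asboolF. Qed.

Lemma coset_ind_in x : incyc c x -> coset_ind x = 1.
Proof. by move=> nx; rewrite /coset_ind boolp.asboolT. Qed.

Lemma coset_fun_mul a : coset_fun (a * (gr k c - 1)) = 0.
Proof.
elim/gring_ind: a => [|e x a IHa]; first by rewrite mul0r coset_fun0.
rewrite mulrDl -scalerAl coset_funZD IHa addr0.
rewrite coset_fun_edge; have [cx | ncx] := boolp.pselect (incyc c x).
  rewrite !coset_ind_in ?subrr ?mulr0 //.
  by apply: incycM => //; apply: incyc_id.
rewrite !coset_ind_out ?subrr ?mulr0 // => cxc; apply: ncx.
by rewrite -[x](mulgK c); apply: incycM => //; apply/incycV/incyc_id.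
Qed.
End CosetIndicator.

Section Words.
Variables (k : fieldType) (F G : groupType) (T1 T2 : finType).
Variables (phi1 : T1 -> F) (phi2 : T2 -> F).
Variables (J1 : free_group T1 -> G) (J2 : free_group T2 -> G).
Hypothesis J1M : forall x y, J1 (x * y)%g = (J1 x * J1 y)%g.
Hypothesis J2M : forall x y, J2 (x * y)%g = (J2 x * J2 y)%g.
Variables (t1 : free_group T1) (t2 : free_group T2).
Local Notation R := (gring k F).
Local Notation f1 := (fhom phi1).
Local Notation f2 := (fhom phi2).
Local Notation c := (f1 t1).
Local Notation letter := (free_group T1 + free_group T2)%type.

Definition letter_val (w : letter) : F := match w with inl a => f1 a | inr b => f2 b end.
Definition letter_img (w : letter) : G := match w with inl a => J1 a | inr b => J2 b end.
Definition word_val (W : seq letter) : F := foldr (fun w x => letter_val w * x)%g 1%g W.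
Definition word_img (W : seq letter) : G := foldr (fun w x => letter_img w * x)%g 1%g W.

(* The part over phi1 of the telescoping sum [gr (P * word_val W) - gr P]. *)
Fixpoint left_sum (P : F) (W : seq letter) : R :=
  if W is w :: W' then
    (if w is inl a then gr k P * (gr k (f1 a) - 1) else 0) +
    left_sum (P * letter_val w)%g W'
  else 0.

Lemma word_val_cat W W' : word_val (W ++ W') = (word_val W * word_val W')%g.
Proof. by elim: W => [|w W IH] /=; rewrite ?mul1g // IH mulgA. Qed.

Lemma word_img_cat W W' : word_img (W ++ W') = (word_img W * word_img W')%g.
Proof. by elim: W => [|w W IH] /=; rewrite ?mul1g // IH mulgA. Qed.

Lemma left_sum_rcons P W w : left_sum P (rcons W w) = left_sum P W +
  (if w is inl a then gr k (P * word_val W)%g * (gr k (f1 a) - 1) else 0).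
Proof.
elim: W P => [|w' W IH] P /=; first by rewrite mulg1 addrC.
by rewrite IH mulgA addrA.
Qed.

Lemma rel_sumD (T : finType) (phi : T -> F) (y z : T -> R) :
  rel_sum phi (fun t => y t + z t) = rel_sum phi y + rel_sum phi z.
Proof. by rewrite /rel_sum -big_split; apply: eq_bigr => t _; rewrite mulrDl. Qed.

Lemma left_sum_rel P W :
  (exists y, left_sum P W = rel_sum phi1 y) /\
  (exists z, gr k P * (gr k (word_val W) - 1) - left_sum P W = rel_sum phi2 z).
Proof.
elim: W P => [|w W IH] P /=.
  split; first by exists (fun=> 0); rewrite rel_sum0.
  by exists (fun=> 0); rewrite rel_sum0 gr1 subrr mulr0 subrr.
have [[y Ey] [z Ez]] := IH (P * letter_val w)%g.
have E : gr k P * (gr k (letter_val w * word_val W)%g - 1) =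
    gr k P * (gr k (letter_val w) - 1) +
    gr k (P * letter_val w)%g * (gr k (word_val W) - 1).
  by rewrite !mulrBr !mulr1 -!grM mulgA [RHS]addrC addrA subrK.
split; case: w Ey Ez E => [a|b] /= Ey Ez E.
- exists (fun t => gr k P * fox k phi1 t (fgval a) + y t).
  by rewrite rel_sumD rel_sumZ rel_sum_fox Ey.
- by exists y; rewrite add0r.
- exists z; rewrite -Ez E opprD addrA; congr (_ - _).
  by rewrite addrAC subrr add0r.
exists (fun t => gr k P * fox k phi2 t (fgval b) + z t).
by rewrite rel_sumD rel_sumZ rel_sum_fox -Ez E add0r addrA.
Qed.

Hypothesis JE : J1 t1 = J2 t2.
Hypothesis fE : f1 t1 = f2 t2.
Hypothesis inj1 : forall x, f1 x = 1%g -> x = 1%g.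
Hypothesis inj2 : forall x, f2 x = 1%g -> x = 1%g.
Hypothesis relation : forall y z, rel_sum phi1 y + rel_sum phi2 z = 0 ->
  exists s : R, rel_sum phi1 y = s * (gr k c - 1).

(** Subtracting the Fox derivatives of s closes the path into a relation, and f1 s - 1 is itself a
    left multiple of c - 1 because s is a power of t1. *)
Lemma left_sum_in_ideal W s : incyc t1 s -> word_val W = f1 s ->
  exists a : R, left_sum 1%g W = a * (gr k c - 1).
Proof.
move=> cs Es; have [[y Ey] [z Ez]] := left_sum_rel 1%g W.
have [|a Ea] := relation (y := fun t => y t + - fox k phi1 t (fgval s)) (z := z).
  rewrite rel_sumD rel_sumN rel_sum_fox -Ey -Ez gr1 mul1r Es.
  by rewrite addrA subrK subrr.
have [b Eb] := incyc_right k (fhom_incyc phi1 cs).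
exists (a + b); rewrite mulrDl -Ea -Eb rel_sumD rel_sumN rel_sum_fox -Ey.
by rewrite subrK.
Qed.

Lemma left_sum_out P W : 
  (forall i, (i <= size W)%N -> ~ incyc c (P * word_val (take i W))%g) ->
  coset_fun c (left_sum P W) = 0.
Proof.
elim: W P => [|w W IH] P H /=; first exact: coset_fun0.
rewrite coset_funD IH ?addr0 => [|i lti]; last by rewrite -mulgA; apply: (H i.+1).
case: w H => [a|b] H; last exact: coset_fun0.
rewrite coset_fun_edge !coset_ind_out ?subrr //.
  by have := H 0 isT; rewrite /= mulg1.
by have := H 1%N isT; rewrite /= take0 /= mulg1.
Qed.

Lemma morph_laws (A B : groupType) (J : A -> B) :
  (forall x y, J (x * y)%g = (J x * J y)%g) ->
  [/\ J 1%g = 1%g, forall x, J x^-1%g = (J x)^-1%g & forall x n, J (x ^+ n)%g = (J x ^+ n)%g].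
Proof.
move=> JM; have J1' : J 1%g = 1%g.
  by apply: (mulgI (J 1%g)); rewrite -JM !mulg1.
split=> // [x|x n]; first by apply/esym/mulg1_eq; rewrite -JM mulgV.
by elim: n => // n IH; rewrite !expgS JM IH.
Qed.

(** The same power of t2: elements of the amalgamated subgroup change factor without changing value
    or image. *)
Lemma twin s : incyc t1 s -> exists s', f2 s' = f1 s /\ J2 s' = J1 s.
Proof.
have [_ J1V J1X] := morph_laws J1M; have [_ J2V J2X] := morph_laws J2M.
move=> [m [n ->]]; exists (t2 ^+ m * t2 ^- n)%g.
rewrite !fhomM !fhomV !fhomX fE J1M J2M J1V J2V !J1X !J2X JE.
by [].
Qed.

Lemma incyc_preim x : incyc c x -> exists2 s, incyc t1 s & f1 s = x.
Proof.
move=> [m [n ->]]; exists (t1 ^+ m * t1 ^- n)%g; first by exists m, n.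
by rewrite fhomM fhomV !fhomX.
Qed.

(** Cyclic permutation of a x b = s that merges b, s^-1 and a. If these lie in one factor they
    become a single letter, and the word is shorter. *)
Lemma rotate_word (A : groupType) (a x b s : A) :
  ((b * s^-1 * a * x)%g = 1%g -> (a * x * b)%g = s) /\
  ((a * x * b)%g = s -> (b * s^-1 * a * x)%g = 1%g).
Proof.
split=> [E|<-].
  have : (b * (s^-1 * (a * x)) = 1)%g by rewrite -E !mulgA.
  by move/mulg1_eq => Eb; rewrite -[b]invgK Eb invgM invgK mulgA mulgV mul1g.
by rewrite !invgM !mulgA mulgV mul1g -(mulgA x^-1%g) mulVg mulg1 mulVg.
Qed.

(** Only the trivial element is wanted in the end, but the induction on the number of letters splits
    words at prefixes in <c>, so all of <c> is carried along. *)
Theorem word_img_incyc W s : incyc t1 s -> word_val W = f1 s -> word_img W = J1 s.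
Proof.
have [J11 J1V _] := morph_laws J1M; have [J21 J2V _] := morph_laws J2M.
have [n] := ubnP (size W); elim/ltn_ind: n W s => n IHn W s le_W cs Es.
have {IHn le_W} IH W' s' : (size W' < size W)%N -> incyc t1 s' ->
    word_val W' = f1 s' -> word_img W' = J1 s'.
  by move=> lt_W'; apply: (IHn (size W)).
case: W Es IH => [|w1 W] Es IH.
  by rewrite (inj1 (esym Es)).
case: (lastP W) Es IH => [|{}W w2] Es IH.
  move: Es; rewrite /= !mulg1; case: w1 {IH} => [a|b] /=.
    by move/(fhom_inj inj1)->.
  have [s' [<- <-]] := twin cs.
  by move/(fhom_inj inj2)->.
set W0 := w1 :: rcons W w2 in Es IH *.
(* Either W0 splits at a proper prefix in <c>, or <c> occurs as a coset only at the
   ends of the path, which [coset_fun] sees unless both ends lie in the same factor;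
   in that case W0 is rotated and shortened. *)
have [[i [lti ci]] | noc] := boolp.pselect (exists i,
    (i <= size W)%N /\ incyc c (word_val (take i.+1 W0))).
  have [s' cs' Es'] := incyc_preim ci.
  have Hd : word_val (drop i.+1 W0) = f1 (s'^-1 * s)%g.
    by rewrite fhomM fhomV Es' -Es -{3}[W0](cat_take_drop i.+1) word_val_cat mulKg.
  rewrite -[W0](cat_take_drop i.+1) word_img_cat.
  rewrite (IH _ _ _ cs' (esym Es')) ?(IH _ _ _ _ Hd) -?J1M ?mulVKg //.
  - by rewrite size_drop ltn_subrL.
  - by apply: incycM => //; apply: incycV.
  by rewrite size_takel /W0 /= size_rcons !ltnS // ltnW.
have out i : (i <= size W)%N -> ~ incyc c (letter_val w1 * word_val (take i W))%g.
  move=> lti ci; apply: noc; exists i; split=> //.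
  by rewrite /W0 /= -cats1 takel_cat.
have EW : (letter_val w1 * word_val W * letter_val w2)%g = f1 s.
  by rewrite -Es /W0 /= -cats1 word_val_cat /= mulg1 mulgA.
have out0 := out 0 isT; rewrite take0 /= mulg1 in out0.
have out1 := out _ (leqnn _); rewrite take_size in out1.
have [a Ea] := left_sum_in_ideal cs Es.
have := coset_fun_mul c a; rewrite -Ea /W0 [left_sum _ _]/= mul1g coset_funD.
rewrite left_sum_rcons coset_funD (left_sum_out out) add0r.
have cf0 : coset_fun c 0 = 0 :> k by exact: coset_fun0.
have one_in : incyc c 1%g by apply: incyc1.
have -> : word_img W0 = (letter_img w1 * word_img W * letter_img w2)%g.
  by rewrite /W0 /= -cats1 word_img_cat /= mulg1 mulgA.
have lt_size : ((size W).+1 < size W0)%N by rewrite /W0 /= size_rcons.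
case: w1 w2 @W0 Es IH noc out EW out0 out1 Ea lt_size =>
    [x1|x1] [x2|x2] /= Es IH noc out EW out0 out1 Ea lt_size.
- move=> _; have := IH (inl (x2 * s^-1 * x1)%g :: W) 1%g lt_size (incyc1 _).
  rewrite /= !fhomM fhomV fhom1 !J1M J1V J11 => IH'.
  by apply: (rotate_word _ _ _ _).1; apply: IH'; apply: (rotate_word _ _ _ _).2.
(* Ends in different factors: just one end of the path contributes to the F1 part, so the functional
   is -1 here and 1 in the next case, but it must be 0. With both ends in F1 the two contributions
   would cancel. *)
- rewrite cf0 addr0 coset_fun_edge mul1g coset_ind_out // coset_ind_in //.
  by rewrite sub0r => /eqP; rewrite oppr_eq0 oner_eq0.
- rewrite cf0 add0r coset_fun_edge EW coset_ind_in; last exact: fhom_incyc.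
  by rewrite coset_ind_out // subr0 => /eqP; rewrite oner_eq0.
have [s' [Ef <-]] := twin cs; rewrite -Ef in EW.
move=> _; have := IH (inr (x2 * s'^-1 * x1)%g :: W) 1%g lt_size (incyc1 _).
rewrite /= !fhomM fhomV fhom1 !J2M J2V J11 => IH'.
by apply: (rotate_word _ _ _ _).1; apply: IH'; apply: (rotate_word _ _ _ _).2.
Qed.

End Words.

(** * Conclusion *)

Lemma morph_wval (T : finType) (A : groupType) (h : free_group T -> A) :
  (forall x y, h (x * y)%g = (h x * h y)%g) ->
  forall x, fhom (fun t => h (fgen t)) x = h x.
Proof.
move=> hM; have [h1 hV _] := morph_laws hM.
move=> x; rewrite -{2}[x]wval_fgen /fhom; elim: (fgval x) => [|[t b] s IH] //=.
by rewrite hM IH /lval; case: b; rewrite /= ?hV.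
Qed.

Section AmalgamKernel.
Variables (T1 T2 T : finType) (G : groupType) (f : G -> free_group T).
Variables (J1 : free_group T1 -> G) (J2 : free_group T2 -> G).
Variables (t1 : free_group T1) (t2 : free_group T2).

Lemma amalgam_kernel :
    (forall x y, f (x * y)%g = (f x * f y)%g) -> (forall y, exists x, f x = y) ->
    (forall x y, J1 (x * y)%g = (J1 x * J1 y)%g) ->
    (forall x y, J2 (x * y)%g = (J2 x * J2 y)%g) ->
    (forall x, exists W, word_img J1 J2 W = x) -> J1 t1 = J2 t2 ->
    (#|T1| + #|T2| = #|T|.+1)%N -> t1 != 1%g -> t2 != 1%g ->
    (forall z, commute t1 z -> incyc t1 z) ->
  forall x, f x = 1%g -> x = 1%g.
Proof.
move=> fM fsurj J1M J2M gen JE cardT t1n1 t2n1 t_ind.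
pose phi1 t := f (J1 (fgen t)); pose phi2 t := f (J2 (fgen t)).
have E1 a : fhom phi1 a = f (J1 a).
  by apply: (@morph_wval _ _ (fun a => f (J1 a))) => u v; rewrite J1M fM.
have E2 b : fhom phi2 b = f (J2 b).
  by apply: (@morph_wval _ _ (fun a => f (J2 a))) => u v; rewrite J2M fM.
have [f1 _ _] := morph_laws fM.
have EW W : word_val phi1 phi2 W = f (word_img J1 J2 W).
  by elim: W => [|[a|b] W IH] //=; rewrite fM IH ?E1 ?E2.
pose g (i : T1 + T2) := match i with inl t => phi1 t | inr t => phi2 t end.
have genl (a : free_group T1) : wval g [seq (inl l.1, l.2) | l <- fgval a] = fhom phi1 a.
  by rewrite /fhom; elim: (fgval a) => [|l s IH] //=; rewrite IH.
have genr (b : free_group T2) : wval g [seq (inr l.1, l.2) | l <- fgval b] = fhom phi2 b.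
  by rewrite /fhom; elim: (fgval b) => [|l s IH] //=; rewrite IH.
have gen_g : generates g.
  move=> y; have [x <-] := fsurj y; have [W <-] := gen x; rewrite -EW.
  elim: W => [|w W [s IH]] /=; first by exists [::].
  case: w => [a|b] /=.
    by exists ([seq (inl l.1, l.2) | l <- fgval a] ++ s); rewrite wval_cat genl IH.
  by exists ([seq (inr l.1, l.2) | l <- fgval b] ++ s); rewrite wval_cat genr IH.
(* The coefficient field is a free choice; the rationals are taken. *)
have [|p _ cyc] := @cyclic_relations_gen rat T (T1 + T2)%type g _ gen_g.
  by rewrite card_sum.
have jc : joint_cyclic phi1 phi2 (fun t => p (inl t)) (fun t => p (inr t)).
  move=> y z E; pose yz (i : T1 + T2) := match i with inl t => y t | inr t => z t end.
  have [|rho Erho] := cyc yz; first by rewrite /rel_sum big_sumType.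
  by exists rho; split=> t; [apply: (Erho (inl t)) | apply: (Erho (inr t))].
have ord := glt_biorder T.
have fE : fhom phi1 t1 = fhom phi2 t2 by rewrite E1 E2 JE.
have inj1 x : fhom phi1 x = 1%g -> x = 1%g.
  by move/(indep_inj (joint_independent ord jc fE t2n1)); rewrite wval_fgen.
have inj2 x : fhom phi2 x = 1%g -> x = 1%g.
  have jc' := joint_cyclic_sym jc.
  by move/(indep_inj (joint_independent ord jc' (esym fE) t1n1)); rewrite wval_fgen.
have rel := joint_relation ord jc fE t1n1 t2n1 t_ind.
move=> x fx; have [W EWx] := gen x; rewrite -EWx in fx *.
have [J11 _ _] := morph_laws J1M.
rewrite (@word_img_incyc rat _ _ _ _ phi1 phi2 J1 J2 J1M J2M t1 t2 JE fE inj1 inj2 rel W 1%g) //.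
  exact: incyc1.
by rewrite EW fx.
Qed.
End AmalgamKernel.

(** * Passage from the groups of the statement to library groups, with classical equality and
    choice *)

Definition gtype (G : group) : Type := carrier G.
HB.instance Definition _ (G : group) := boolp.gen_eqMixin (gtype G).
HB.instance Definition _ (G : group) := boolp.gen_choiceMixin (gtype G).
HB.instance Definition _ (G : group) := isGroup.Build (gtype G)
  (@gmulA G) (@gmul1g G) (@gmulg1 G) (@gmulVg G) (@gmulgV G).

Definition group_of (F : groupType) : group :=
  @Defs.Group F (@monoid.mul F) 1%g (@monoid.inv F) (@mulgA F) (@mul1g F) (@mulg1 F)
    (@mulVg F) (@mulgV F).

Lemma gpow_natE (G : group) (x : G) n : gpow_nat x n = ((x : gtype G) ^+ n)%g.
Proof. by elim: n => //= n ->; rewrite expgS. Qed.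

Lemma gpow_sub (G : group) (x : G) (m n : nat) :
  gpow x (Z.sub (Z.of_nat m) (Z.of_nat n)) =
  ((x : gtype G) ^+ m * (x : gtype G) ^- n)%g.
Proof.
have [le_nm | /ltnW le_mn] := leqP n m.
  rewrite -expgnFr //; have -> : Z.sub (Z.of_nat m) (Z.of_nat n) = Z.of_nat (m - n).
    by rewrite -minusE Nat2Z.inj_sub //; apply/ssrnat.leP.
  by case: (m - n)%N => [|p] //=; rewrite gpow_natE SuccNat2Pos.id_succ.
have -> : Z.sub (Z.of_nat m) (Z.of_nat n) = Z.opp (Z.of_nat (n - m)).
  by rewrite -minusE Nat2Z.inj_sub; [rewrite Z.opp_sub_distr Z.add_comm | apply/ssrnat.leP].
rewrite -(subnK le_mn) expgnDr invgM mulgA [(_ * _ ^- m)%g](_ : _ = 1%g); last first.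
  exact: mulgV.
rewrite mul1g addnK.
by case: (n - m)%N => [|p] /=; rewrite ?invg1 // gpow_natE SuccNat2Pos.id_succ.
Qed.

Lemma incyc_trans (F : groupType) (t x y : F) : incyc t x -> incyc x y -> incyc t y.
Proof.
move=> tx [m [n ->]]; have pow p : incyc t (x ^+ p)%g.
  by elim: p => [|p IH]; [apply: incyc1 | rewrite expgS; apply: incycM].
by apply: incycM => //; apply: incycV.
Qed.

Definition ord_fin n (i : 'I_n) : fin n := exist _ (i : nat) (elimT ssrnat.ltP (ltn_ord i)).
Definition fin_ord n (i : fin n) : 'I_n := Ordinal (introT ssrnat.ltP (proj2_sig i)).

Lemma ord_finK n : cancel (@ord_fin n) (@fin_ord n).
Proof. by move=> i; apply: val_inj. Qed.

Lemma fin_ordK n : cancel (@fin_ord n) (@ord_fin n).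
Proof.
by case=> i lti; rewrite /ord_fin /=; congr exist; apply: boolp.Prop_irrelevance.
Qed.

(** Replaces a group known only by its universal property by the model of reduced words. *)
Lemma free_of_rank_iso (Fr : group) n : free_of_rank Fr n ->
  exists (u : free_group 'I_n -> gtype Fr) (v : gtype Fr -> free_group 'I_n),
  [/\ forall x y, u (x * y)%g = (u x * u y)%g,
      forall x y, v (x * y)%g = (v x * v y)%g, cancel u v & cancel v u].
Proof.
case=> b basis_b; pose u := @fhom (gtype Fr) _ (fun i => b (ord_fin i)).
have [v [vM [vb _]]] :=
  basis_b (group_of (free_group 'I_n)) (fun i => @fgen 'I_n (fin_ord i)).
have uM x y : u (x * y)%g = (u x * u y)%g by apply: fhomM.
exists u, v; split=> // x.
  have vuM (y z : free_group 'I_n) : v (u (y * z)%g) = (v (u y) * v (u z))%g.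
    by rewrite uM; apply: vM.
  rewrite -[LHS](@morph_wval _ (free_group 'I_n) (fun y => v (u y)) vuM).
  have E t : v (u (fgen t)) = fgen t by rewrite /u fhom_fgen vb ord_finK.
  rewrite -[RHS](wval_fgen x) /fhom.
  elim: (fgval x) => [|[t e] s IH] //=; rewrite IH /lval /=.
  by case: e; rewrite /= E.
have [phi [_ [_ uniq]]] := basis_b Fr b.
transitivity (phi x).
  apply: (uniq (fun y => u (v y))) => [y z|i]; first by rewrite vM; apply: uM.
  by rewrite vb /u fhom_fgen fin_ordK.
by apply/esym/(uniq (fun y => y)).
Qed.

(** The subgroup cut out by P receives both factors compatibly, so the pushout maps to it. Followed
    by the inclusion this is the identity, by uniqueness; hence the subgroup is everything. *)
Lemma amalgam_generated (F1 F2 G : group) (t1 : F1) (t2 : F2) (j1 : F1 -> G) (j2 : F2 -> G)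
    (P : G -> Prop) :
    amalgam t1 t2 j1 j2 -> P gone -> (forall x y, P x -> P y -> P (gmul x y)) ->
    (forall x, P x -> P (ginv x)) -> (forall a, P (j1 a)) -> (forall b, P (j2 b)) ->
  forall x, P x.
Proof.
case=> j1M [j2M [jE univ]] P1 PM PV Pj1 Pj2.
have sub_inj (a b : {x | P x}) : proj1_sig a = proj1_sig b -> a = b.
  by case: a b => [x p] [y q] /= E; case: y / E q => q; congr exist; apply: boolp.Prop_irrelevance.
pose mulS (a b : {x | P x}) : {x | P x} :=
  exist P (gmul (proj1_sig a) (proj1_sig b)) (PM _ _ (proj2_sig a) (proj2_sig b)).
pose oneS : {x | P x} := exist P gone P1.
pose invS (a : {x | P x}) : {x | P x} := exist P (ginv (proj1_sig a)) (PV _ (proj2_sig a)).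
have SA a b c : mulS a (mulS b c) = mulS (mulS a b) c by apply/sub_inj/gmulA.
have S1g a : mulS oneS a = a by apply/sub_inj/gmul1g.
have Sg1 a : mulS a oneS = a by apply/sub_inj/gmulg1.
have SVg a : mulS (invS a) a = oneS by apply/sub_inj/gmulVg.
have SgV a : mulS a (invS a) = oneS by apply/sub_inj/gmulgV.
pose S := @Defs.Group {x | P x} mulS oneS invS SA S1g Sg1 SVg SgV.
pose k1 a : S := exist P (j1 a) (Pj1 a); pose k2 b : S := exist P (j2 b) (Pj2 b).
have k1M : is_hom k1 by move=> a b; apply/sub_inj/j1M.
have k2M : is_hom k2 by move=> a b; apply/sub_inj/j2M.
have kE : k1 t1 = k2 t2 by apply: sub_inj.
have [phi [phiM [phi1 [phi2 _]]]] := univ S k1 k2 k1M k2M kE.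
have [id' [_ [_ [_ uniq]]]] := univ G j1 j2 j1M j2M jE.
move=> x; have -> : x = proj1_sig (phi x); last exact: proj2_sig.
transitivity (id' x); first exact: (uniq (fun y => y)).
apply/esym/(uniq (fun y => proj1_sig (phi y))).
- by move=> y z; rewrite phiM.
- by move=> y; rewrite phi1.
by move=> y; rewrite phi2.
Qed.

Lemma amalgam_sym (F1 F2 G : group) (t1 : F1) (t2 : F2) (j1 : F1 -> G) (j2 : F2 -> G) :
  amalgam t1 t2 j1 j2 -> amalgam t2 t1 j2 j1.
Proof.
case=> j1M [j2M [jE univ]]; split=> //; split=> //; split; first exact: esym.
move=> H f2 f1 f2M f1M fE; have [phi [phiM [E1 [E2 uniq]]]] := univ H f1 f2 f1M f2M (esym fE).
by exists phi; do 3!split=> //; move=> psi psiM psi2 psi1; apply: uniq.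
Qed.

(** Commuting elements t and z are powers of a common w, and indivisibility makes w equal to t or
    its inverse. *)
Lemma indivisible_centralizer n (t : free_group 'I_n) (F : group)
    (u : free_group 'I_n -> gtype F) :
  (forall x y, u (x * y)%g = (u x * u y)%g) -> indivisible (u t : F) ->
  forall z, commute t z -> incyc t z.
Proof.
move=> uM ind z /commute_incyc[w [[a [b Et]] wz]]; apply: incyc_trans wz.
have [_ uV uX] := morph_laws uM.
have : gpow (u w : F) (Z.sub (Z.of_nat a) (Z.of_nat b)) = u t.
  by rewrite gpow_sub Et uM uV !uX.
move/ind => [] E.
  have Ea : a = b.+1 by lia.
  by rewrite Et Ea expgS mulgK; apply: incyc_id.
have Eb : b = a.+1 by lia.
suff -> : w = t^-1%g by apply/incycV/incyc_id.
by rewrite Et Eb expgS invgM invgK mulgK.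
Qed.

(** Indivisibility is placed in the first factor; the other case follows by exchanging the
    factors. *)
Lemma amalgam_kernel_half (n m r : nat) (F1 F2 Fr G : group) (t1 : F1) (t2 : F2)
    (j1 : F1 -> G) (j2 : F2 -> G) (f : G -> Fr) :
    free_of_rank F1 n -> free_of_rank F2 m -> free_of_rank Fr r -> (n + m)%N = r.+1 ->
    t1 <> gone -> t2 <> gone -> amalgam t1 t2 j1 j2 -> indivisible t1 ->
    is_hom f -> surjective f ->
  forall x, f x = gone -> x = gone.
Proof.
move=> /free_of_rank_iso[u1 [v1 [u1M v1M u1K v1K]]].
move=> /free_of_rank_iso[u2 [v2 [u2M v2M u2K v2K]]].
move=> /free_of_rank_iso[u [v [uM vM uK vK]]] Enm t1n1 t2n1 am ind fM fsurj.
have [j1M [j2M [jE _]]] := am.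
have [u1_1 _ _] := morph_laws u1M; have [u2_1 _ _] := morph_laws u2M.
have [v_1 _ _] := morph_laws vM.
pose J1 (a : free_group 'I_n) : gtype G := j1 (u1 a).
pose J2 (b : free_group 'I_m) : gtype G := j2 (u2 b).
pose h (x : gtype G) : free_group 'I_r := v (f x).
have J1M x y : J1 (x * y)%g = (J1 x * J1 y)%g by rewrite /J1 u1M; apply: j1M.
have J2M x y : J2 (x * y)%g = (J2 x * J2 y)%g by rewrite /J2 u2M; apply: j2M.
have hM x y : h (x * y)%g = (h x * h y)%g by rewrite /h -vM; congr v; apply: fM.
have [J1_1 J1V _] := morph_laws J1M; have [J2_1 J2V _] := morph_laws J2M.
have gen : forall x : gtype G, exists W, word_img J1 J2 W = x.
  apply: (amalgam_generated am).
  - by exists [::].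
  - move=> _ _ [W <-] [W' <-]; exists (W ++ W'); exact: word_img_cat.
  - move=> _ [W <-]; elim: W => [|w W [W' EW']].
      by exists [::]; apply/esym/(@invg1 (gtype G)).
    exists (W' ++ [:: match w with inl a => inl a^-1%g | inr b => inr b^-1%g end]).
    rewrite word_img_cat EW' [RHS](@invgM (gtype G)); congr (_ * _)%g.
    by case: w => [a|b] /=; rewrite mulg1 ?J1V ?J2V.
  - by move=> a; exists [:: inl (v1 a)]; rewrite /= mulg1 /J1 v1K.
  by move=> b; exists [:: inr (v2 b)]; rewrite /= mulg1 /J2 v2K.
have hsurj y : exists x, h x = y.
  by have [x Ex] := fsurj (u y); exists x; rewrite /h Ex uK.
have JE : J1 (v1 t1) = J2 (v2 t2) by rewrite /J1 /J2 v1K v2K.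
have card : (#|'I_n| + #|'I_m| = #|'I_r|.+1)%N by rewrite !card_ord.
have t1c : v1 t1 != 1%g by apply/eqP => /(congr1 u1); rewrite v1K u1_1.
have t2c : v2 t2 != 1%g by apply/eqP => /(congr1 u2); rewrite v2K u2_1.
have cent : forall z, commute (v1 t1) z -> incyc (v1 t1) z.
  by apply: (@indivisible_centralizer _ _ F1 u1) => //; rewrite v1K.
move=> x fx; apply: (amalgam_kernel hM hsurj J1M J2M gen JE card t1c t2c cent).
by rewrite /h fx; apply: v_1.
Qed.

Lemma free_of_bijective_hom (Fr G : group) (r : nat) (f : G -> Fr) :
  free_of_rank Fr r -> is_hom f -> injective f -> surjective f -> is_free G.
Proof.
case=> b basis_b fM finj /boolp.choice[fV fVK].
exists (fin r), (fun i => fV (b i)) => H h.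
have [phi [phiM [phib uniq]]] := basis_b H h.
exists (fun x => phi (f x)); split=> [x y|]; first by rewrite fM.
split=> [i|psi psiM psib x]; first by rewrite fVK.
rewrite -(uniq (fun y => psi (fV y))) => // [|y z].
  by congr psi; apply: finj; rewrite fVK.
by rewrite -psiM; congr psi; apply: finj; rewrite fM !fVK.
Qed.

(** A free group of rank 0 is trivial. Positivity makes the truncated difference [n + m - 1] a true
    predecessor of n + m. *)
Lemma rank_gt0 (F : group) n (t : F) : free_of_rank F n -> t <> gone -> (0 < n)%N.
Proof.
move=> /free_of_rank_iso[u [v [uM vM uK vK]]] t1; case: n u v uM vM uK vK => // u v.
move=> uM _ uK vK; case: t1; rewrite -(vK t); have [u1 _ _] := morph_laws uM.
rewrite -[RHS]u1; congr u; case: (v t) => -[|[[]]//] ?; exact: val_inj.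
Qed.

Theorem theorem1p2 (n m : nat) (F1 F2 : group)
  (hF1 : free_of_rank F1 n) (hF2 : free_of_rank F2 m)
  (t1 : F1) (t2 : F2) (ht1 : t1 <> gone) (ht2 : t2 <> gone)
  (G : group) (j1 : F1 -> G) (j2 : F2 -> G)
  (hG : amalgam t1 t2 j1 j2)
  (hind : indivisible t1 \/ indivisible t2)
  (hcork : corank_is G (n + m - 1)%coq_nat) :
  is_free G.
Proof.
have n0 := rank_gt0 hF1 ht1.
case: hcork => -[Fr [f [hFr [fM fsurj]]]] _.
have ker x : f x = gone -> x = gone.
  have E : (n + m)%N = (n + m - 1)%coq_nat.+1 by rewrite -subnE -plusE; lia.
  case: hind => ind; first exact: (amalgam_kernel_half hF1 hF2 hFr E ht1 ht2 hG ind fM fsurj).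
  move=> fx; apply: (amalgam_kernel_half hF2 hF1 hFr (etrans (addnC m n) E) ht2 ht1 (amalgam_sym hG) ind fM fsurj fx).
apply: (free_of_bijective_hom hFr fM _ fsurj) => x y Exy.
have [_ fV _] := @morph_laws (gtype G) (gtype Fr) f fM.
apply: (@divg1_eq (gtype G)); apply: ker.
by rewrite [LHS]fM [X in gmul _ X]fV Exy gmulgV.
Qed.
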